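(* Let $f\in\mathbb{R}[x]$, $g=(g_1,\dots,g_m)$ and $h=(h_1,\dots,h_l)$ with $g_i,h_j\in\mathbb{R}[x]$, $x=(x_1,\dots,x_n)$. Let $\hat h=(\hat h_1,\dots,\hat h_r)$ with $\hat h_t\in\mathbb{R}[x_{n+1}]$ be the output of the algorithm described in the context with input $f,g,h$. Then $V(\hat h)=Z(f(S(g)\cap V(h)))$.
   Context: $S(g):=\{x\in\mathbb{R}^n:g_j(x)\ge0,\ j=1,\dots,m\}$. For a tuple or finite set of polynomials $p$ in $N$ variables, $V(p)\subset\mathbb{R}^N$ is the set of common real zeros (so $V(\emptyset)$ is the whole space) and $I(p)$ is the ideal generated by $p$. $Z(A)$ is the Zariski closure of $A$: the smallest real variety (set of common real zeros of finitely many real polynomials) containing $A$. For an ideal $I$ of a real polynomial ring $R$, the real radical is $\sqrt[\mathbb{R}]{I}=\{p\in R:\exists k\in\mathbb{N},\ -p^{2k}\in\Sigma^2+I\}$, with $\Sigma^2$ the sums of squares in $R$; equivalently (real Nullstellensatz), the set of polynomials vanishing on the real zero set of $I$. Algorithm. Input: $f,g,h$. Let $y=(y_1,\dots,y_m)$ and $x_{n+1}$ be new variables. (a) Set $\tilde h:=(g_1-y_1^2,\dots,g_m-y_m^2,h)$. (b) Compute a finite set of generators $\check h\subset\mathbb{R}[x,y,x_{n+1}]$ of $\sqrt[\mathbb{R}]{I(\tilde h,\,x_{n+1}-f)}$. (c) Compute a Gröbner basis $h^G$ of $I(\check h)$ with respect to the lexicographic order $x_1\succ\dots\succ x_n\succ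 y_1\succ\dots\succ y_m\succ x_{n+1}$. (d) Output $\hat h:=h^G\cap\mathbb{R}[x_{n+1}]$. Any choice of generators and of Gröbner basis is allowed. *)

(* Defs.v *)
From mathcomp Require Export all_boot all_order all_algebra.
From mathcomp Require Export boolp classical_sets reals.
From mathcomp Require Export mpoly.

Set Implicit Arguments.
Unset Strict Implicit.
Unset Printing Implicit Defensive.

Import Order.TTheory GRing.Theory Num.Theory.

Local Open Scope classical_set_scope.
Local Open Scope ring_scope.

(* Points of R^N are functions 'I_N -> R, the argument type of [_.@[_]]. *)

Definition zero_set (R : realType) (N : nat) (P : set {mpoly R[N]}) :
    set ('I_N -> R) :=
  [set x | forall p, P p -> p.@[x] = 0].

Definition nonneg_set (R : realType) (n m : nat) (g : m.-tuple {mpoly R[n]}) :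
    set ('I_n -> R) :=
  [set x | forall j : 'I_m, 0 <= (tnth g j).@[x]].

Definition real_variety (R : realType) (N : nat) (W : set ('I_N -> R)) : Prop :=
  exists s : seq {mpoly R[N]}, W = zero_set [set` s].

Definition zariski_closure (R : realType) (N : nat) (A : set ('I_N -> R)) :
    set ('I_N -> R) :=
  smallest (@real_variety R N) A.

Definition ideal_gen (R : realType) (N : nat) (P : set {mpoly R[N]}) :
    set {mpoly R[N]} :=
  [set p | exists s : seq ({mpoly R[N]} * {mpoly R[N]}),
    (forall c, c \in s -> P c.2) /\ p = \sum_(c <- s) c.1 * c.2].

Definition sums_of_squares (R : realType) (N : nat) : set {mpoly R[N]} :=
  [set p | exists s : seq {mpoly R[N]}, p = \sum_(a <- s) a ^+ 2].

Definition real_radical (R : realType) (N : nat) (I : set {mpoly R[N]}) :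
    set {mpoly R[N]} :=
  [set p | exists (k : nat) (a q : {mpoly R[N]}),
    [/\ sums_of_squares a, I q & - p ^+ (2 * k) = a + q]].

(* [<=%O] on 'X_{1..N} is graded, so exponent vectors are compared as elements
   of [N.-tuplelexi nat]: this is the lexicographic order in which the variable
   of index 0 is the largest.  [\bot] is the zero exponent vector. *)
Definition lex_lm (R : realType) (N : nat) (p : {mpoly R[N]}) : 'X_{1..N} :=
  Multinom
    (\big[Order.max / \bot%O]_(m <- msupp p) (multinom_val m : N.-tuplelexi nat)).

Definition lex_lt (R : realType) (N : nat) (p : {mpoly R[N]}) : {mpoly R[N]} :=
  p@_(lex_lm p) *: 'X_[lex_lm p].

Definition lex_groebner_basis (R : realType) (N : nat) (I : set {mpoly R[N]})
    (G : seq {mpoly R[N]}) : Prop :=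
  [set` G] `<=` I /\
  ideal_gen [set lex_lt p | p in [set` G]] = ideal_gen [set lex_lt p | p in I].

(* The ring R[x, y, x_{n+1}] is {mpoly R[n + m + 1]}, its variables listed in
   this order, so that x_1 > .. > x_n > y_1 > .. > y_m > x_{n+1}. *)

Definition embed_x (R : realType) (n m : nat) (p : {mpoly R[n]}) :
    {mpoly R[n + m + 1]} :=
  p \mPo [tuple 'X_(lshift 1 (lshift m i)) | i < n].

Definition var_y (R : realType) (n m : nat) (j : 'I_m) : {mpoly R[n + m + 1]} :=
  'X_(lshift 1 (rshift n j)).

Definition var_t (R : realType) (n m : nat) : {mpoly R[n + m + 1]} :=
  'X_(rshift (n + m) ord0).

Definition embed_t (R : realType) (n m : nat) (q : {mpoly R[1]}) :
    {mpoly R[n + m + 1]} :=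
  q \mPo [tuple var_t R n m | _ < 1].

Definition h_tilde (R : realType) (n m l : nat)
    (g : m.-tuple {mpoly R[n]}) (h : l.-tuple {mpoly R[n]}) :
    seq {mpoly R[n + m + 1]} :=
  [seq embed_x m (tnth g j) - var_y R n j ^+ 2 | j : 'I_m] ++
  [seq embed_x m p | p <- h].

(* The algorithm is nondeterministic: any generators [hcheck] of the real radical
   and any Groebner basis [hG] are allowed, so it is rendered as a relation.  The
   last clause says that [hhat] lists the elements of [hG] lying in R[x_{n+1}],
   identified with {mpoly R[1]} through [embed_t]. *)
Definition algorithm_output (R : realType) (n m l : nat) (f : {mpoly R[n]})
    (g : m.-tuple {mpoly R[n]}) (h : l.-tuple {mpoly R[n]})
    (hhat : seq {mpoly R[1]}) : Prop :=
  exists hcheck hG : seq {mpoly R[n + m + 1]},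
    [/\ ideal_gen [set` hcheck] =
          real_radical
            (ideal_gen [set` rcons (h_tilde g h) (var_t R n m - embed_x m f)]),
        lex_groebner_basis (ideal_gen [set` hcheck]) hG &
        forall q : {mpoly R[1]}, (q \in hhat) = (embed_t n m q \in hG)].

(* Main.v *)
(* By elimination theory the ideal generated by [hhat] is the intersection of the
   ideal computed in step (b) with R[x_{n+1}], so everything rests on the real
   Nullstellensatz: a polynomial vanishing on the real zeros of an ideal I lies in
   its real radical.  If no -q^(2k) lies in the sums of squares modulo I, Zorn's
   lemma gives an ordering of R[x]/p for some prime ideal p containing I but not q;
   this ordered ring embeds into a real closed field K, in which the system I = 0,
   q <> 0 has a solution.  Quantifier elimination transfers the solution to R.
   The real coefficients are first replaced by variables, so that all rings are
   countable and K can be found inside a countable algebraic closure. *)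

From HB Require Import structures.
Require Import Defs.
From mathcomp Require Import generic_quotient fraction ring_quotient closed_field.
From mathcomp Require Import ring lra zify.
From mathcomp Require qe_rcf qe_rcf_th.

Set Implicit Arguments.
Unset Strict Implicit.
Unset Printing Implicit Defensive.

Import Order.TTheory GRing.Theory Num.Theory.

Local Open Scope classical_set_scope.
Local Open Scope ring_scope.

(** * Uniform quantifier elimination *)

(** [K] is found inside a countable field, so R does not embed in it and the two fields cannot be
    compared along a morphism. They are compared at two finite tuples instead: the coefficients [c]
    in R and their counterparts [eK] in [K], at which every polynomial with rational coefficients
    takes the same sign. This suffices once quantifiers are eliminated by a single formula with
    rational constants, valid in both fields. The signs agree because a nonnegative real constant is
    a square in R[x], hence belongs to the preordering that is pulled back to the countable ring.

    No real closure is constructed either. In an algebraically closed field a maximal cone orders a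
    subfield, and maximality itself yields the intermediate value property of that subfield. *)

(* [qe_rcf] eliminates quantifiers over one real closed field at a time.  Its
   elimination commutes with morphisms of the constants, hence a formula with
   rational constants has the same quantifier-free equivalent in all of them. *)
Module MapFormula.
Import qe_rcf.

Section MapFormula.
Variables (F G : realFieldType) (phi : {rmorphism F -> G}).

Fixpoint tmap (t : term F) : term G :=
  match t with
  | Var i => Var _ i
  | Const x => Const (phi x)
  | NatConst n => NatConst _ n
  | Add u v => Add (tmap u) (tmap v)
  | Opp u => Opp (tmap u)
  | NatMul u n => NatMul (tmap u) n
  | Mul u v => Mul (tmap u) (tmap v)
  | Exp u n => Exp (tmap u) n
  end.

Fixpoint fmap (f : formula F) : formula G :=
  match f with
  | Bool b => Bool b
  | Equal t u => Equal (tmap t) (tmap u)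
  | Lt t u => Lt (tmap t) (tmap u)
  | Le t u => Le (tmap t) (tmap u)
  | And f g => And (fmap f) (fmap g)
  | Or f g => Or (fmap f) (fmap g)
  | Implies f g => Implies (fmap f) (fmap g)
  | Not f => Not (fmap f)
  end.

Local Notation pmap := (map tmap).

Lemma tmapC0 : tmap (Const 0) = Const 0.
Proof. by rewrite /= rmorph0. Qed.

(** The procedures of [qe_rcf] are in continuation-passing style, each test on a coefficient
    becoming an [If] in the output. Commutation is therefore assumed of the continuation and
    concluded for the call, as a syntactic equality of formulas. *)
Lemma fmap_Size p k k' : (forall n, fmap (k n) = k' n) ->
  fmap (Size p k) = Size (pmap p) k'.
Proof.
elim: p k k' => [|c p IH] k k' kk' /=; first exact: kk'.
apply: IH => -[|m]; last exact: kk'.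
by rewrite /If /= !kk'.
Qed.

Lemma fmap_Isnull p k k' : (forall b, fmap (k b) = k' b) ->
  fmap (Isnull p k) = Isnull (pmap p) k'.
Proof. by move=> kk'; apply: fmap_Size => n; apply: kk'. Qed.

Lemma fmap_LtSize p q k k' : (forall b, fmap (k b) = k' b) ->
  fmap (LtSize p q k) = LtSize (pmap p) (pmap q) k'.
Proof. by move=> kk'; do 2!apply: fmap_Size => ?; apply: kk'. Qed.

Lemma fmap_LeadCoef p k k' : (forall t, fmap (k t) = k' (tmap t)) ->
  fmap (LeadCoef p k) = LeadCoef (pmap p) k'.
Proof.
elim: p k k' => [|c p IH] k k' kk' /=; first by rewrite kk' tmapC0.
by apply: IH => l; rewrite /If /= !kk'.
Qed.

Lemma pmap_AmulXn a n : pmap (AmulXn a n) = AmulXn (tmap a) n.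
Proof. by elim: n => //= n ->; rewrite rmorph0. Qed.

Lemma pmap_AddPoly p q : pmap (AddPoly p q) = AddPoly (pmap p) (pmap q).
Proof. by elim: p q => [|a p IH] [|b q] //=; rewrite IH. Qed.

Lemma pmap_ScalPoly c p : pmap (ScalPoly c p) = ScalPoly (tmap c) (pmap p).
Proof. by rewrite /ScalPoly -!map_comp. Qed.

Lemma pmap_MulPoly p q : pmap (MulPoly p q) = MulPoly (pmap p) (pmap q).
Proof.
by elim: p q => [|a p IH] q //=; rewrite pmap_AddPoly /= pmap_ScalPoly IH.
Qed.

Lemma pmap_ExpPoly p n : pmap (ExpPoly p n) = ExpPoly (pmap p) n.
Proof.
case: n => // n; rewrite /ExpPoly !iteropS.
by elim: n => //= n IH; rewrite pmap_MulPoly IH.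
Qed.

Lemma pmap_OppPoly p : pmap (OppPoly p) = OppPoly (pmap p).
Proof. by rewrite /OppPoly pmap_ScalPoly /= rmorphN1. Qed.

Lemma pmap_NatMulPoly n p : pmap (NatMulPoly n p) = NatMulPoly n (pmap p).
Proof. by rewrite /NatMulPoly pmap_ScalPoly. Qed.

Lemma pmap_Deriv p : pmap (Deriv p) = Deriv (pmap p).
Proof. by elim: p => //= a p IH; rewrite pmap_AddPoly /= IH. Qed.

Definition pmap_OpPoly := (pmap_AddPoly, pmap_ScalPoly, pmap_MulPoly,
  pmap_ExpPoly, pmap_OppPoly, pmap_NatMulPoly, pmap_Deriv, pmap_AmulXn).

Lemma fmap_Rediv_rec_loop q sq cq c qq r n k k' :
  (forall c qq r, fmap (k (c, qq, r)) = k' (c, pmap qq, pmap r)) ->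
  fmap (Rediv_rec_loop q sq cq c qq r n k) =
  Rediv_rec_loop (pmap q) sq (tmap cq) c (pmap qq) (pmap r) n k'.
Proof.
move=> kk'; elim: n c qq r => [|n IH] c qq r /=; apply: fmap_Size => sr;
  case: ifP => // _; apply: fmap_LeadCoef => lr.
  by rewrite kk' !pmap_OpPoly.
by rewrite IH !pmap_OpPoly.
Qed.

Lemma fmap_Rediv p q k k' :
  (forall c qq r, fmap (k (c, qq, r)) = k' (c, pmap qq, pmap r)) ->
  fmap (Rediv p q k) = Rediv (pmap p) (pmap q) k'.
Proof.
move=> kk'; apply: fmap_Isnull => -[]; first by rewrite kk' /= rmorph0.
apply: fmap_Size => sq; apply: fmap_Size => sp; apply: fmap_LeadCoef => lq.
by rewrite (fmap_Rediv_rec_loop _ _ _ _ _ _ _ kk') /= rmorph0.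
Qed.

Lemma fmap_Rmod p q k k' : (forall r, fmap (k r) = k' (pmap r)) ->
  fmap (Rmod p q k) = Rmod (pmap p) (pmap q) k'.
Proof. by move=> kk'; apply: fmap_Rediv => c qq r /=. Qed.

Lemma fmap_Rscal p q k k' : (forall n, fmap (k n) = k' n) ->
  fmap (Rscal p q k) = Rscal (pmap p) (pmap q) k'.
Proof. by move=> kk'; apply: fmap_Rediv => c qq r /=. Qed.

Lemma fmap_Rgcd_loop n p q k k' : (forall r, fmap (k r) = k' (pmap r)) ->
  fmap (Rgcd_loop n p q k) = Rgcd_loop n (pmap p) (pmap q) k'.
Proof.
move=> kk'; elim: n p q => [|n IH] p q /=;
  apply: fmap_Rmod => r; apply: fmap_Isnull => -[] //.
Qed.

Lemma fmap_Rgcd p q k k' : (forall r, fmap (k r) = k' (pmap r)) ->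
  fmap (Rgcd p q k) = Rgcd (pmap p) (pmap q) k'.
Proof.
move=> kk'; apply: fmap_LtSize => -[]; apply: fmap_Isnull => -[] //;
  by apply: fmap_Size => n; apply: fmap_Rgcd_loop.
Qed.

Lemma fmap_BigRgcd ps k k' : (forall r, fmap (k r) = k' (pmap r)) ->
  fmap (BigRgcd ps k) = BigRgcd (map pmap ps) k'.
Proof.
elim: ps k k' => [|p ps IH] k k' kk' /=; first by rewrite kk' /= rmorph0.
by apply: IH => r; apply: fmap_Rgcd.
Qed.

Lemma fmap_Changes s k k' : (forall n, fmap (k n) = k' n) ->
  fmap (Changes s k) = Changes (pmap s) k'.
Proof.
elim: s k k' => [|a s IH] k k' kk' /=; first exact: kk'.
by apply: IH => v; rewrite /If /= !kk'; case: s.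
Qed.

Lemma fmap_SeqPInfty ps k k' : (forall s, fmap (k s) = k' (pmap s)) ->
  fmap (SeqPInfty ps k) = SeqPInfty (map pmap ps) k'.
Proof.
elim: ps k k' => [|p ps IH] k k' kk' /=; first exact: kk'.
by apply: fmap_LeadCoef => l; apply: IH => s; rewrite kk'.
Qed.

Lemma fmap_SeqMInfty ps k k' : (forall s, fmap (k s) = k' (pmap s)) ->
  fmap (SeqMInfty ps k) = SeqMInfty (map pmap ps) k'.
Proof.
elim: ps k k' => [|p ps IH] k k' kk' /=; first exact: kk'.
apply: fmap_LeadCoef => l; apply: fmap_Size => n; apply: IH => s.
by rewrite kk' /= rmorphN1.
Qed.

Lemma fmap_ChangesPoly ps k k' : (forall n, fmap (k n) = k' n) ->
  fmap (ChangesPoly ps k) = ChangesPoly (map pmap ps) k'.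
Proof.
move=> kk'; apply: fmap_SeqMInfty => ms; apply: fmap_SeqPInfty => qs.
by apply: fmap_Changes => vm; apply: fmap_Changes => vp; apply: kk'.
Qed.

Lemma fmap_NextMod p q k k' : (forall r, fmap (k r) = k' (pmap r)) ->
  fmap (NextMod p q k) = NextMod (pmap p) (pmap q) k'.
Proof.
move=> kk'; apply: fmap_LeadCoef => l; apply: fmap_Rscal => n.
by apply: fmap_Rmod => r; rewrite kk' pmap_ScalPoly.
Qed.

Lemma fmap_ModsAux p q n k k' : (forall s, fmap (k s) = k' (map pmap s)) ->
  fmap (ModsAux p q n k) = ModsAux (pmap p) (pmap q) n k'.
Proof.
elim: n p q k k' => [|n IH] p q k k' kk' /=; first exact: kk'.
apply: fmap_Isnull => -[]; first exact: kk'.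
by apply: fmap_NextMod => r; apply: IH => s; rewrite kk'.
Qed.

Lemma fmap_Mods p q k k' : (forall s, fmap (k s) = k' (map pmap s)) ->
  fmap (Mods p q k) = Mods (pmap p) (pmap q) k'.
Proof. by move=> kk'; do 2!apply: fmap_Size => ?; apply: fmap_ModsAux. Qed.

Lemma pmap_PolyComb sq sc : pmap (PolyComb sq sc) = PolyComb (map pmap sq) sc.
Proof.
rewrite /PolyComb size_map; elim: (iota _ _) => //= i s IH.
rewrite pmap_MulPoly IH pmap_ExpPoly; congr (MulPoly (ExpPoly _ _) _).
by elim: sq i {IH} => [|a sq IH] [|i] //=.
Qed.

Lemma fmap_TaqR p q k k' : (forall n, fmap (k n) = k' n) ->
  fmap (TaqR p q k) = TaqR (pmap p) (pmap q) k'.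
Proof.
move=> kk'; rewrite /TaqR -pmap_Deriv -pmap_MulPoly.
by apply: fmap_Mods => r; apply: fmap_ChangesPoly.
Qed.

Lemma fmap_TaqsR p sq i k k' : (forall t, fmap (k t) = k' (tmap t)) ->
  fmap (TaqsR p sq i k) = TaqsR (pmap p) (map pmap sq) i k'.
Proof.
move=> kk'; rewrite /TaqsR.
have -> : Pcq (map pmap sq) i = pmap (Pcq sq i).
  rewrite /Pcq size_map; elim: (qe_rcf_th.sg_tab _) i => [|s ss IH] [|i] //=.
  by rewrite pmap_PolyComb.
by apply: fmap_TaqR => n; rewrite kk' /= rmorph_int.
Qed.

Lemma pmap_BoundingPoly sq : pmap (BoundingPoly sq) = BoundingPoly (map pmap sq).
Proof.
rewrite /BoundingPoly pmap_Deriv; congr Deriv.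
by elim: sq => //= p sq IH; rewrite pmap_MulPoly IH.
Qed.

(** The coefficients that turn Tarski queries into a root count are listed for [n <= 1] and
    otherwise are entries of the inverse of an integer matrix; field morphisms commute with
    [invmx]. *)
Lemma tmap_Coefs n i : tmap (Coefs F n i) = Coefs G n i.
Proof.
case: n => [|[|n]] /=; congr Const.
- by rewrite rmorph_nat.
- by case: i => [|[|[|i]]] /=; rewrite ?nth_nil ?fmorphV ?rmorph_nat ?rmorph0.
- rewrite /qe_rcf_th.coefs.
  case: (ltnP i (3 ^ n.+2)) => ilt; last first.
    by rewrite !nth_default ?rmorph0 // size_map size_enum_ord.
  rewrite !(nth_map (Ordinal ilt)) -?enumT ?size_enum_ord // !castmxE.
  set M := qe_rcf_th.ctmat n.+2.
  have -> : map_mx (intr : int -> G) M = map_mx phi (map_mx intr M).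
    by apply/matrixP => a b; rewrite !mxE rmorph_int.
  by rewrite -map_invmx [RHS]mxE.
Qed.

Lemma fmap_CcountWeak p sq k k' : (forall t, fmap (k t) = k' (tmap t)) ->
  fmap (CcountWeak p sq k) = CcountWeak (pmap p) (map pmap sq) k'.
Proof.
(* The initial accumulator is rewritten as an image under [tmap], so that the induction can
   generalize over it. *)
move=> kk'; rewrite /CcountWeak size_map -[0%qfT in RHS]/(tmap 0%qfT).
elim: (3 ^ size sq)%N (0%qfT : term F) => [|i IH] s; first exact: kk'.
apply: fmap_TaqsR => x; rewrite -tmap_Coefs.
exact: (IH (x * Coefs F (size sq) i + s)%qfT).
Qed.

Lemma fmap_CcountGt0 sp sq :
  fmap (CcountGt0 sp sq) = CcountGt0 (map pmap sp) (map pmap sq).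
Proof.
apply: fmap_BigRgcd => p; apply: fmap_Isnull => -[] /=.
  rewrite -pmap_BoundingPoly; apply: fmap_CcountWeak => c /=.
  congr (Or _ (Or _ _)).
    by elim: sq => //= q sq <-; congr And; apply: fmap_LeadCoef.
  by elim: sq => //= q sq <-; congr And; apply: fmap_Size => n; apply: fmap_LeadCoef.
by apply: fmap_CcountWeak.
Qed.

Lemma pmap_abstrX i t : pmap (abstrX i t) = abstrX i (tmap t).
Proof.
elim: t => //= [n|u IHu v IHv|u IHu|u IHu n|u IHu v IHv|u IHu n].
- by case: ifP.
- by rewrite pmap_AddPoly IHu IHv.
- by rewrite pmap_OppPoly IHu.
- by rewrite pmap_NatMulPoly IHu.
- by rewrite pmap_MulPoly IHu IHv.
- by rewrite pmap_ExpPoly IHu.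
Qed.

End MapFormula.

(** * Quantifier elimination for formulas with rational constants *)

Definition qsat (K : rcfType) (e : seq K) (f : formula rat) : bool :=
  qf_eval e (fmap ratr f).

Definition qval (K : rcfType) (e : seq K) (t : term rat) : K :=
  eval e (tmap ratr t).

(** The input format of [CcountGt0]: terms that must vanish, and terms that must be positive. *)
Definition clause := (seq (term rat) * seq (term rat))%type.

Definition clause_sat (K : rcfType) (e : seq K) (c : clause) : bool :=
  all (fun t => qval e t == 0) c.1 && all (fun t => 0 < qval e t) c.2.

Definition dnf_and (s1 s2 : seq clause) : seq clause :=
  [seq (c1.1 ++ c2.1, c1.2 ++ c2.2) | c1 <- s1, c2 <- s2]%SEQ.

(* [dnf b f] represents [f] if [b] holds, and the negation of [f] otherwise. *)
Fixpoint dnf (b : bool) (f : formula rat) : seq clause :=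
  let gt0 t := ([::], [:: t]) in
  let eq0 t := ([:: t], [::]) in
  let join (c : bool) s1 s2 := if c then dnf_and s1 s2 else (s1 ++ s2)%SEQ in
  match f with
  | Bool c => if c == b then [:: ([::], [::])] else [::]
  | Equal t u => if b then [:: eq0 (t - u)%qfT]
                 else [:: gt0 (t - u)%qfT; gt0 (u - t)%qfT]
  | Lt t u => if b then [:: gt0 (u - t)%qfT]
              else [:: eq0 (t - u)%qfT; gt0 (t - u)%qfT]
  | Le t u => if b then [:: eq0 (t - u)%qfT; gt0 (u - t)%qfT]
              else [:: gt0 (t - u)%qfT]
  | And f g => join b (dnf b f) (dnf b g)
  | Or f g => join (~~ b) (dnf b f) (dnf b g)
  | Implies f g => join (~~ b) (dnf (~~ b) f) (dnf b g)
  | Not f => dnf (~~ b) f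
  end.

Lemma has_dnf_and (K : rcfType) (e : seq K) s1 s2 :
  has (clause_sat e) (dnf_and s1 s2) =
  has (clause_sat e) s1 && has (clause_sat e) s2.
Proof.
elim: s1 => //= c1 s1 IH; rewrite has_cat IH andb_orl; congr orb.
rewrite has_map; elim: s2 {IH} => [|c2 s2 IH] /=; first by rewrite andbF.
rewrite IH andb_orr; congr orb.
by rewrite /clause_sat /= !all_cat andbACA.
Qed.

Lemma has_dnf (K : rcfType) (e : seq K) b f :
  has (clause_sat e) (dnf b f) = (qsat e f == b).
Proof.
elim: f b => [c|t u|t u|t u|f IHf g IHg|f IHf g IHg|f IHf g IHg|f IHf] b;
  rewrite /qsat /=; rewrite -?/(qsat e _).
- by case: c b => [] [].
- case: b; rewrite /clause_sat /= /qval /= ?subr_gt0 ?subr_eq0 ?andbT ?orbF.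
    by rewrite eqb_id.
  by rewrite -neq_lt eq_sym; case: (_ == _).
- case: b; rewrite /clause_sat /= /qval /= ?subr_gt0 ?subr_eq0 ?andbT ?orbF.
    by rewrite eqb_id.
  by rewrite eq_sym -le_eqVlt leNgt; case: (_ < _).
- case: b; rewrite /clause_sat /= /qval /= ?subr_gt0 ?subr_eq0 ?andbT ?orbF.
    by rewrite -le_eqVlt; case: (_ <= _).
  by rewrite ltNge; case: (_ <= _).
- by case: b; rewrite ?has_dnf_and ?has_cat IHf IHg; do 2!case: qsat.
- by case: b; rewrite ?has_dnf_and ?has_cat IHf IHg; do 2!case: qsat.
- by case: b; rewrite ?has_dnf_and ?has_cat IHf IHg; do 2!case: qsat.
- by rewrite IHf; case: qsat b => [] [].
Qed.

Local Notation pmap := (map (tmap ratr)).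

Lemma set_nth_size (T : Type) (x0 : T) s x : set_nth x0 s (size s) x = rcons s x.
Proof. by elim: s => //= y s ->. Qed.

Definition elim_var (i : nat) (f : formula rat) : formula rat :=
  foldr (fun c => Or (CcountGt0 (map (abstrX i) c.1) (map (abstrX i) c.2)))
    False (dnf true f).

(** An existential quantifier distributes over the clauses of [dnf true f]. For one clause, [abstrX]
    turns the terms into polynomials in the last variable, and [CcountGt0] decides whether they have
    a common solution. *)
Lemma qsat_elim_var (K : rcfType) (e : seq K) (f : formula rat) :
  reflect (exists x, qsat (rcons e x) f) (qsat e (elim_var (size e) f)).
Proof.
have -> : qsat e (elim_var (size e) f) =
    has (fun c => `[< exists x, clause_sat (rcons e x) c >]) (dnf true f).
  rewrite /elim_var; elim: (dnf true f) => // c s IH.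
  rewrite [LHS]/(qsat e (CcountGt0 _ _) || _) [RHS]/(_ || _).
  congr orb; last exact: IH.
  rewrite /qsat fmap_CcountGt0 eval_CcountGt0.
  have abstrE t x : (eval_poly e (pmap (abstrX (size e) t))).[x] =
      qval (rcons e x) t by rewrite pmap_abstrX abstrXP set_nth_size.
  have satE x : clause_sat (rcons e x) c =
      \big[andb/true]_(p <- [seq eval_poly e i | i <-
        [seq pmap i | i <- [seq abstrX (size e) i | i <- c.1]]]) (p.[x] == 0)
   && \big[andb/true]_(p <- [seq eval_poly e i | i <-
        [seq pmap i | i <- [seq abstrX (size e) i | i <- c.2]]]) (0 < p.[x]).
    rewrite !big_map !big_all; congr andb; apply: eq_all => t /=;
    by rewrite abstrE.
  by apply/qe_rcf_th.ccount_gt0P/asboolP => -[x cx]; exists x; rewrite ?satE // -satE.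
under eq_exists do rewrite -[qsat _ _]eqb_id -has_dnf.
elim: (dnf true f) => [|c s IH] /=; first by constructor => -[].
apply: (iffP orP) => [[/asboolP[x cx]|/IH[x sx]]|[x /orP[cx|sx]]].
- by exists x; rewrite cx.
- by exists x; rewrite sx orbT.
- by left; apply/asboolP; exists x.
- by right; apply/IH; exists x.
Qed.

Definition elim_vars (i N : nat) (f : formula rat) : formula rat :=
  foldr elim_var f (iota i N).

Lemma qsat_elim_vars (K : rcfType) N (e : seq K) (f : formula rat) :
  reflect (exists xs, size xs = N /\ qsat (e ++ xs) f)
    (qsat e (elim_vars (size e) N f)).
Proof.
rewrite /elim_vars; elim: N e => [|N IH] e /=.
  apply: (iffP idP) => [ef|[xs [/size0nil ->]]]; last by rewrite cats0.
  by exists [::]; rewrite cats0.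
apply: (iffP (qsat_elim_var _ _)) => [[x]|[xs []]].
  rewrite -[(size e).+1](size_rcons e x) => /IH[xs [xsN exs]].
  by exists (x :: xs); rewrite /= xsN -cat_rcons.
case: xs => // x xs [xsN] exs.
exists x; rewrite -[(size e).+1](size_rcons e x); apply/IH.
by exists xs; rewrite cat_rcons.
Qed.

(** Equalities and weak inequalities are combinations of negated strict ones, so signs of terms
    decide every quantifier-free formula. *)
Lemma qsat_transfer (K L : rcfType) (e : seq K) (e' : seq L) :
  (forall t, (0 < qval e t) = (0 < qval e' t)) ->
  forall f, qsat e f = qsat e' f.
Proof.
move=> ee' f.
have lt_ee' t u : (qval e t < qval e u) = (qval e' t < qval e' u).
  by have := ee' (u - t)%qfT; rewrite /qval /= !subr_gt0.
elim: f => //=.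
- move=> t u; rewrite -[LHS]/(qval e t == qval e u).
  by rewrite -[RHS]/(qval e' t == qval e' u) !eq_le !leNgt !lt_ee'.
- move=> t u; rewrite -[LHS]/(qval e t <= qval e u).
  by rewrite -[RHS]/(qval e' t <= qval e' u) !leNgt lt_ee'.
- by move=> f; rewrite /qsat /= => -> g ->.
- by move=> f; rewrite /qsat /= => -> g ->.
- by move=> f; rewrite /qsat /= => -> g ->.
- by move=> f; rewrite /qsat /= => ->.
Qed.

End MapFormula.

(** * Orderings of rings and real closed fields *)

(** [Zorn_bigcup] also asks about the empty chain, whose union need not satisfy [P]. Maximizing over
    the sets whose union with [A0] satisfies [P] reduces that case to [A0] itself. *)
Lemma Zorn_above (T : Type) (P : set (set T)) (A0 : set T) :
  P A0 ->
  (forall F : set (set T), F !=set0 -> F `<=` P -> total_on F subset ->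
    P (\bigcup_(X in F) X)) ->
  exists A, [/\ A0 `<=` A, P A & forall B, A `<=` B -> P B -> B `<=` A].
Proof.
move=> PA0 Pcup.
have [|A [PA Amax]] := @Zorn_bigcup T [set X | P (A0 `|` X)].
  move=> F FP Ftot; have [->|/set0P[X0 FX0]] := eqVneq F set0.
    by rewrite /= bigcup_set0 setU0.
  set G := [set A0 `|` X | X in F].
  rewrite /=; have -> : A0 `|` \bigcup_(X in F) X = \bigcup_(X in G) X.
    apply/seteqP; split=> x.
      case=> [A0x|[X FX Xx]]; first by exists (A0 `|` X0); [exists X0|left].
      by exists (A0 `|` X); [exists X|right].
    by case=> _ [X FX <-] [A0x|Xx]; [left|right; exists X].
  apply: Pcup; first by exists (A0 `|` X0), X0.
    by move=> _ [X FX <-]; apply: FP.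
  move=> _ _ [X FX <-] [Y FY <-].
  by case: (Ftot X Y FX FY) => XY; [left|right]; apply: setUS.
exists (A0 `|` A); split=> [x||B AB PB]; [by left|by []|move=> x Bx].
right; apply: contrapT => nAx; apply: (Amax B); last first.
  by rewrite /= setUidr // => y A0y; apply: AB; left.
by split=> [y Ay|BA]; [apply: AB; right|apply/nAx/BA].
Qed.

(** * Preorderings of commutative rings *)

Record precone (A : comNzRingType) (T : set A) : Prop := Precone {
  preconeD : forall x y, T x -> T y -> T (x + y);
  preconeM : forall x y, T x -> T y -> T (x * y);
  precone_sqr : forall x, T (x ^+ 2)
}.

Section PreconeTheory.
Variables (A : comNzRingType) (T : set A).
Hypothesis coneT : precone T.

Lemma precone0 : T 0.
Proof. by have := precone_sqr coneT 0; rewrite expr0n. Qed.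

Lemma precone1 : T 1.
Proof. by have := precone_sqr coneT 1; rewrite expr1n. Qed.

Definition cone_adjoin (a : A) : set A :=
  [set x | exists s t, [/\ T s, T t & x = s + a * t]].

Lemma sub_cone_adjoin a : T `<=` cone_adjoin a.
Proof.
by move=> x Tx; exists x, 0; rewrite mulr0 addr0; split=> //; apply: precone0.
Qed.

Lemma cone_adjoin_gen a : cone_adjoin a a.
Proof.
by exists 0, 1; rewrite mulr1 add0r; split=> //; [apply: precone0|apply: precone1].
Qed.

Lemma precone_adjoin a : precone (cone_adjoin a).
Proof.
case: (coneT) => TD TM Tsq; split=> [x y|x y|x].
- move=> [s [t [Ts Tt ->]]] [s' [t' [Ts' Tt' ->]]].
  by exists (s + s'), (t + t'); split; [apply: (TD)|apply: (TD)|ring].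
- move=> [s [t [Ts Tt ->]]] [s' [t' [Ts' Tt' ->]]].
  exists (s * s' + a ^+ 2 * (t * t')), (s * t' + s' * t).
  by split; [do ?[exact: (Tsq)|apply: (TD)|apply: (TM)]
    |do ?[apply: (TD)|apply: (TM)]|ring].
- by exists (x ^+ 2), 0; rewrite mulr0 addr0; split=> //; apply: precone0.
Qed.

End PreconeTheory.

Lemma precone_bigcup (A : comNzRingType) (F : set (set A)) :
  F !=set0 -> F `<=` @precone A -> total_on F subset ->
  precone (\bigcup_(X in F) X).
Proof.
move=> [X0 FX0] FP Ftot.
have common x y : (\bigcup_(X in F) X) x -> (\bigcup_(X in F) X) y ->
    exists X, [/\ F X, X x & X y].
  move=> [X FX Xx] [Y FY Yy]; case: (Ftot X Y FX FY) => XY.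
    by exists Y; split=> //; apply: XY.
  by exists X; split=> //; apply: XY.
split=> [x y Fx Fy|x y Fx Fy|x]; last by exists X0 => //; case: (FP _ FX0).
  have [X [FX Xx Xy]] := common x y Fx Fy; exists X => //.
  by case: (FP _ FX) => XD _ _; apply: XD.
have [X [FX Xx Xy]] := common x y Fx Fy; exists X => //.
by case: (FP _ FX) => _ XM _; apply: XM.
Qed.

(* Localizing at the multiplicative set [U] of squares makes the support of a
   maximal cone a prime ideal disjoint from [U]; [U = [set 1]] is the usual
   notion of a maximal proper preordering. *)
Lemma max_precone (A : comNzRingType) (T U : set A) :
  precone T -> U 1 -> (forall u v, U u -> U v -> U (u * v)) -> U `<=` T ->
  (forall u, U u -> ~ T (- u)) ->
  exists P, [/\ T `<=` P, precone P, forall u, U u -> ~ P (- u),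
    forall x, P x \/ P (- x) &
    forall x y, P (x * y) -> P (- (x * y)) ->
      (P x /\ P (- x)) \/ (P y /\ P (- y))].
Proof.
move=> coneT U1 UM UT TU.
pose Q := [set X : set A | precone X /\ forall u, U u -> ~ X (- u)].
have [|F F0 FQ Ftot|P [TP [coneP PU] Pmax]] := @Zorn_above A Q T.
- by split.
- split; first by apply: precone_bigcup => // X /FQ[].
  by move=> u Uu [X /FQ[_ XU]]; apply: XU.
have UP u : U u -> P u by move=> /UT/TP.
have [PD PM Psq] := coneP.
have adjoinN a : ~ P a -> exists u s t, [/\ U u, P s, P t & - u = s + a * t].
  move=> nPa; apply: contrapT => nex; apply: nPa.
  apply: (Pmax (cone_adjoin P a)); [exact: sub_cone_adjoin| |exact: cone_adjoin_gen].
  split; first exact: precone_adjoin.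
  by move=> u Uu [s [t [Ps Pt E]]]; apply: nex; exists u, s, t.
have Ptot x : P x \/ P (- x).
  apply: contrapT => /not_orP[/adjoinN[u [s [t [Uu Ps Pt E]]]]].
  move=> /adjoinN[v [s' [t' [Uv Ps' Pt' E']]]].
  apply: (PU (u * v)); first exact: UM.
  (* Obtained by multiplying [u + s = - x * t] with [v + s' = x * t']. *)
  have -> : - (u * v) = s * v + s' * u + s * s' + x ^+ 2 * (t * t').
    have Eu : u = - s - x * t by rewrite -[u]opprK E; ring.
    have Ev : v = - s' + x * t' by rewrite -[v]opprK E'; ring.
    by rewrite Eu Ev; ring.
  by do ?[exact: (Psq)|apply: (PD)|apply: (PM)];
    do ?[exact: (UP)].
exists P; split=> // x y.
wlog Px : x / P x.
  move=> H; case: (Ptot x) => Px; first exact: H.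
  by move=> Pxy Nxy; have := H _ Px; rewrite mulNr !opprK => /(_ Nxy Pxy); tauto.
wlog Py : y / P y.
  move=> H; case: (Ptot y) => Py; first exact: H.
  by move=> Pxy Nxy; have := H _ Py; rewrite mulrN !opprK => /(_ Nxy Pxy); tauto.
move=> Pxy Nxy; apply: contrapT => /not_orP[nx ny].
have /adjoinN[u [s [t [Uu Ps Pt E]]]] : ~ P (- x) by tauto.
have /adjoinN[v [s' [t' [Uv Ps' Pt' E']]]] : ~ P (- y) by tauto.
apply: (PU (u * v)); first exact: UM.
have -> : - (u * v) = s * v + s' * u + s * s' + - (x * y) * (t * t').
  have Eu : u = - s + x * t by rewrite -[u]opprK E; ring.
  have Ev : v = - s' + y * t' by rewrite -[v]opprK E'; ring.
  by rewrite Eu Ev; ring.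
by do ?[exact: (Psq)|apply: (PD)|apply: (PM)];
    do ?[exact: (UP)].
Qed.

(** * Ordered subfields given by cones *)

Record field_cone (Omega : fieldType) (T : set Omega) : Prop := FieldCone {
  fconeD : forall x y, T x -> T y -> T (x + y);
  fconeM : forall x y, T x -> T y -> T (x * y);
  fconeV : forall x, T x -> T x^-1;
  fcone_sqrB : forall x y, T x -> T y -> T ((x - y) ^+ 2);
  fcone1 : T 1;
  fconeN1 : ~ T (-1)
}.

(** In an algebraically closed field -1 is a square, so a cone cannot contain all squares:
    [fcone_sqrB] asks only for those of differences of its elements. A field cone is thus a
    preordering of the subfield of these differences, and totality makes it an ordering there. *)
Record total_cone (Omega : fieldType) := TotalCone {
  tcone :> Omega -> Prop;
  tcone_cone : field_cone tcone;
  tcone_total : forall x y, tcone x -> tcone y -> tcone (x - y) \/ tcone (y - x)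
}.

Section ConeField.
Variables (Omega : fieldType) (T : total_cone Omega).

Let TD x y : T x -> T y -> T (x + y). Proof. exact: fconeD (tcone_cone T) _ _. Qed.
Let TM x y : T x -> T y -> T (x * y). Proof. exact: fconeM (tcone_cone T) _ _. Qed.
Let TV x : T x -> T x^-1. Proof. exact: fconeV (tcone_cone T) _. Qed.
Let T1 : T 1. Proof. exact: fcone1 (tcone_cone T). Qed.

Definition cone_pred : pred Omega := fun x => `[< T x \/ T (- x) >].

Lemma cone_predP x : reflect (T x \/ T (- x)) (x \in cone_pred).
Proof. exact: asboolP. Qed.

Lemma cone_pred_divring : divring_closed cone_pred.
Proof.
split.
- by apply/cone_predP; left.
- move=> x y /cone_predP[Tx|Nx] /cone_predP[Ty|Ny]; apply/cone_predP.
  + by rewrite opprB; apply: tcone_total.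
  + by left; apply: TD.
  + by right; rewrite opprB addrC; apply: TD => //; rewrite opprK.
  + by case: (tcone_total Nx Ny) => H; [right|left]; move: H;
      rewrite opprK ?opprB addrC.
- move=> x y /cone_predP[Tx|Nx] /cone_predP[Ty|Ny]; apply/cone_predP.
  + by left; apply/TM/TV.
  + by right; rewrite -mulrN -invrN; apply/TM/TV.
  + by right; rewrite -mulNr; apply/TM/TV.
  + by left; rewrite -[x]opprK mulNr -mulrN -invrN; apply/TM/TV.
Qed.

HB.instance Definition _ :=
  GRing.isDivringClosed.Build Omega cone_pred cone_pred_divring.

Record cone_field := ConeField {
  cone_val :> Omega;
  cone_valP : cone_val \in cone_pred
}.

HB.instance Definition _ := [isSub for cone_val].
HB.instance Definition _ := [Choice of cone_field by <:].
HB.instance Definition _ := [SubChoice_isSubIntegralDomain of cone_field by <:].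
HB.instance Definition _ :=
  [SubIntegralDomain_isSubField of cone_field by <:].

Definition cone_le (x y : cone_field) : bool := `[< T (val y - val x) >].
Definition cone_norm (x : cone_field) : cone_field :=
  if cone_le 0 x then x else - x.

Lemma cone_leP x y : reflect (T (val y - val x)) (cone_le x y).
Proof. exact: asboolP. Qed.

Lemma cone_le0P x : reflect (T (val x)) (cone_le 0 x).
Proof. by apply: (iffP (cone_leP _ _)); rewrite rmorph0 subr0. Qed.

Fact cone_le0D x y : cone_le 0 x -> cone_le 0 y -> cone_le 0 (x + y).
Proof. by move=> /cone_le0P ? /cone_le0P ?; apply/cone_le0P/TD. Qed.

Fact cone_le0M x y : cone_le 0 x -> cone_le 0 y -> cone_le 0 (x * y).
Proof. by move=> /cone_le0P ? /cone_le0P ?; apply/cone_le0P/TM. Qed.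

Fact cone_le0_anti x : cone_le 0 x -> cone_le x 0 -> x = 0.
Proof.
move=> /cone_le0P Tx /cone_leP; rewrite rmorph0 sub0r => Nx.
apply: contrapT => x0; apply: (fconeN1 (tcone_cone T)).
rewrite -(@divff _ (val x)) -?mulNr; first by apply/TM/TV.
by apply: contra_not_neq x0 => x0; apply: val_inj; rewrite rmorph0.
Qed.

Fact cone_sub_ge0 x y : cone_le 0 (y - x) = cone_le x y.
Proof. by apply/cone_le0P/cone_leP; rewrite rmorphB. Qed.

Fact cone_le0_total x : cone_le 0 x || cone_le x 0.
Proof.
have /cone_predP[Tx|Nx] := cone_valP x; apply/orP; first by left; apply/cone_le0P.
by right; apply/cone_leP; rewrite rmorph0 sub0r.
Qed.

Fact cone_normN x : cone_norm (- x) = cone_norm x.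
Proof.
have := cone_le0_total x; have := @cone_le0_anti x.
rewrite /cone_norm -sub0r cone_sub_ge0 sub0r opprK.
case: (cone_le 0 x); case: (cone_le x 0) => // -> //.
by rewrite oppr0.
Qed.

Fact cone_ge0_norm x : cone_le 0 x -> cone_norm x = x.
Proof. by rewrite /cone_norm => ->. Qed.

HB.instance Definition _ := Num.IntegralDomain_isLeReal.Build cone_field
  cone_le0D cone_le0M cone_le0_anti cone_sub_ge0 cone_le0_total cone_normN
  cone_ge0_norm (fun _ _ => erefl).

Lemma cone_ge0P (x : cone_field) : reflect (T (val x)) (0 <= x).
Proof. exact: cone_le0P. Qed.

End ConeField.

(** Carries a sign change of a polynomial over to a cofactor whose product with it is positive
    everywhere. *)
Lemma mul_lt0_transfer (F : realDomainType) (u v x y : F) :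
  0 < u * x -> 0 < v * y -> x * y < 0 -> u * v < 0.
Proof.
move=> ux vy xy; rewrite ltNge; apply/negP => uv.
have := mulr_gt0 ux vy; rewrite mulrACA ltNge => /negP; apply.
by rewrite mulr_ge0_le0 // ltW.
Qed.

(** * Weighted sums of squares of polynomials *)

Section WeightedSquares.
Variable F : realFieldType.

(** Positive elements of [F] need not be squares in [F], hence the weights [c]. *)
Inductive wsos : {poly F} -> Prop :=
| wsos0 : wsos 0
| wsosS c f q of 0 <= c & wsos q : wsos (c *: f ^+ 2 + q).

Lemma wsos1 c f : 0 <= c -> wsos (c *: f ^+ 2).
Proof. by move=> c0; rewrite -[X in wsos X]addr0; apply: wsosS => //; apply: wsos0. Qed.

Lemma wsosD q r : wsos q -> wsos r -> wsos (q + r).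
Proof.
by elim=> [|c f q' c0 _ IH] Hr; rewrite ?add0r // -addrA; apply: wsosS => //; apply: IH.
Qed.

Lemma wsosM q r : wsos q -> wsos r -> wsos (q * r).
Proof.
elim=> [|c f q' c0 _ IHq] Hr; first by rewrite mul0r; apply: wsos0.
rewrite mulrDl; apply: wsosD; last exact: IHq.
elim: Hr => [|d g r' d0 _ IHr]; first by rewrite mulr0; apply: wsos0.
rewrite mulrDr; apply: wsosD => //.
by rewrite -scalerAl -scalerAr scalerA -exprMn; apply: wsos1; apply: mulr_ge0.
Qed.

Lemma wsos_ge0 q x : wsos q -> 0 <= q.[x].
Proof.
elim=> [|c f r c0 _ IH]; first by rewrite horner0.
by rewrite hornerD hornerZ horner_exp addr_ge0 // mulr_ge0 // sqr_ge0.
Qed.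

(** Each [f] is reduced modulo [p] rather than the sum, so the result is again a weighted sum of
    squares. Its degree is at most [2 * (deg p - 1)], so that a quotient by [p] has degree below
    [deg p]. *)
Lemma wsos_mod (p q : {poly F}) : (1 < size p)%N -> wsos q ->
  exists2 r, wsos r & (p %| q - r) && (size r < (size p).-1.*2)%N.
Proof.
move=> p1; elim=> [|c f q' c0 _ [r wr /andP[pqr sr]]].
  exists 0; first exact: wsos0.
  by rewrite subrr dvdp0 size_poly0 double_gt0 -subn1 subn_gt0.
exists (c *: (f %% p) ^+ 2 + r); first exact: wsosS.
apply/andP; split.
  have -> : c *: f ^+ 2 + q' - (c *: (f %% p) ^+ 2 + r) =
      c *: ((f - f %% p) * (f + f %% p)) + (q' - r).
    by rewrite -subr_sqr scalerBr opprD addrACA.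
  apply: dvdp_add => //; rewrite -mul_polyC; apply: dvdp_mull.
  by apply: dvdp_mulr; rewrite {1}(divp_eq f p) addrK dvdp_mulIr.
have p0 : p != 0 by rewrite -size_poly_gt0 (leq_trans _ p1).
have fp := ltn_modp f p; rewrite p0 in fp.
rewrite (leq_ltn_trans (size_polyD _ _)) // gtn_max sr andbT.
rewrite (leq_ltn_trans (size_scale_leq _ _)) //.
rewrite (leq_ltn_trans (size_poly_exp_leq _ _)) // muln2.
by move: (size p) (size (f %% p)) p1 fp => n m; lia.
Qed.

End WeightedSquares.

(** * The intermediate value property for a maximal cone *)

Section MaximalCone.
Variables (Omega : closedFieldType) (T : total_cone Omega).
Hypothesis Tmax : forall B : set Omega, T `<=` B -> field_cone B -> B `<=` T.
Local Notation F := (cone_field T).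

Section Root.
Variables (p : {poly F}) (alpha : Omega).
Hypothesis p_irr : irreducible_poly p.
Hypothesis p_alpha : root (map_poly val p) alpha.

Let ev (q : {poly F}) : Omega := (map_poly val q).[alpha].

Lemma irr_coprimep q : ~~ (p %| q) -> coprimep p q.
Proof.
move=> pq; rewrite -gcdp_eqp1.
have [//|gp] := irredp_XsubCP p_irr (dvdp_gcdl p q).
by case/negP: pq; rewrite -(eqp_dvdl _ gp) dvdp_gcdr.
Qed.

Lemma irr_ev_eq0 q : ev q = 0 -> p %| q.
Proof.
move=> q0; apply: contraT => pq.
have /coprimep_root/(_ p_alpha) : coprimep (map_poly val p) (map_poly val q).
  by rewrite coprimep_map irr_coprimep.
by rewrite -/(ev q) q0 eqxx.
Qed.

(** The cone generated by [T] and the squares of F[alpha]. *)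
Definition cone_ext : set Omega := [set x | exists2 q, wsos q & x = ev q].

Lemma field_cone_ext : ~ cone_ext (-1) -> field_cone cone_ext.
Proof.
move=> N1; have evM q r : ev (q * r) = ev q * ev r by rewrite /ev rmorphM hornerM.
have evD q r : ev (q + r) = ev q + ev r by rewrite /ev rmorphD hornerD.
have evB q r : ev (q - r) = ev q - ev r by rewrite /ev rmorphB hornerD hornerN.
have ev1 : ev 1 = 1 by rewrite /ev rmorph1 hornerC.
have wsq q : wsos (q ^+ 2) by rewrite -[X in wsos X]scale1r; apply: wsos1; apply: ler01.
split=> //.
- by move=> _ _ [q wq ->] [r wr ->]; exists (q + r); [apply: wsosD|rewrite evD].
- by move=> _ _ [q wq ->] [r wr ->]; exists (q * r); [apply: wsosM|rewrite evM].
- move=> _ [q wq ->]; have [q0|q0] := eqVneq (ev q) 0.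
    by rewrite q0 invr0; exists q.
  have pq : coprimep p q.
    rewrite irr_coprimep //; apply: contra q0 => /dvdpP[r ->].
    by rewrite evM [ev p](eqP p_alpha) mulr0.
  have /Bezout_eq1_coprimepP[[u v] /= uv] := pq.
  (* An inverse is written [1/e = e * (1/e)^2] to stay a weighted sum of squares; [v] is an inverse
     of [q] modulo [p]. *)
  exists (q * v ^+ 2); first exact: wsosM.
  have vV : ev v * ev q = 1.
    by rewrite -ev1 -uv evD !evM [ev p](eqP p_alpha) mulr0 add0r.
  have -> : (ev q)^-1 = ev v by apply: (mulIf q0); rewrite mulVf.
  by rewrite expr2 !evM mulrA [ev q * _]mulrC vV mul1r.
- move=> _ _ [q wq ->] [r wr ->]; exists ((q - r) ^+ 2) => //.
  by rewrite expr2 evM evB.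
- by exists (1 ^+ 2); rewrite // expr1n ev1.
Qed.

(** If [cone_ext] missed -1, maximality would place it inside [T]. Then [alpha = (alpha + 1)^2 / 4 -
    (alpha - 1)^2 / 4] would lie in [F], and [p] would divide a linear polynomial. *)
Lemma irr_cone_ext_N1 : (2 < size p)%N -> cone_ext (-1).
Proof.
move=> p2; apply: contrapT => N1.
have ext_sub := Tmax _ (field_cone_ext N1).
have evC c : ev c%:P = val c by rewrite /ev map_polyC hornerC.
have {}ext_sub q : wsos q -> T (ev q).
  move=> wq; apply: ext_sub; last by exists q.
  move=> x Tx; have xc : x \in cone_pred T by apply/cone_predP; left.
  exists ((ConeField xc) *: 1 ^+ 2).
    by apply: wsos1; apply/cone_ge0P.
  by rewrite expr1n -mul_polyC mulr1 evC.
pose sq c : {poly F} := 4^-1 *: ('X + c%:P) ^+ 2.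
have wsq c : wsos (sq c) by apply: wsos1; rewrite invr_ge0 ler0n.
have alphaE : alpha = ev (sq 1) - ev (sq (-1)).
  have sqE : 'X = sq 1 - sq (-1).
    transitivity (4^-1 *: ((4 : F) *: ('X : {poly F}))).
      by rewrite scalerA mulVf ?scale1r ?pnatr_eq0.
    by rewrite /sq -scalerBr polyCN; congr (_ *: _); rewrite -mul_polyC; ring.
  have <- : ev 'X = alpha by rewrite /ev map_polyX hornerX.
  by rewrite {1}sqE /ev rmorphB hornerD hornerN.
have alphaF : alpha \in cone_pred T.
  rewrite alphaE; apply: (rpredB _ _); apply/cone_predP; left; exact: ext_sub.
have /dvdp_leq : p %| 'X - (ConeField alphaF)%:P.
  apply: irr_ev_eq0.
  by rewrite /ev map_polyXsubC hornerXsubC subrr.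
by rewrite polyXsubC_eq0 size_XsubC => /(_ isT); rewrite leqNgt p2.
Qed.

End Root.

(* An irreducible [p] of degree > 1 that changes sign would allow the cone to be
   extended by a root of [p]: otherwise [1 + sum c_i f_i^2 = h p] with
   [deg h < deg p], and [h] changes sign as well, so by induction it has a root,
   where the left-hand side is positive. *)
Lemma max_cone_root_sign n (p : {poly F}) (a b : F) : (size p <= n)%N ->
  a < b -> p.[a] * p.[b] < 0 -> exists2 x, a < x < b & root p x.
Proof.
elim: n p => [|n IH] p.
  by rewrite size_poly_leq0 => /eqP-> _; rewrite !horner0 mul0r ltxx.
move=> pn ab pab.
have p0 : p != 0 by apply: contraTneq pab => ->; rewrite !horner0 mul0r ltxx.
have p1 : (1 < size p)%N.
  rewrite ltnNge; apply: contraTN pab => /size1_polyC ->.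
  by rewrite !hornerC -leNgt -expr2 sqr_ge0.
have [p2|p2] := leqP (size p) 2.
  have sp : size p = 2%N by apply/eqP; rewrite eqn_leq p2 p1.
  have lp0 : p`_1 != 0 by rewrite -[1%N]/(2.-1) -sp -lead_coefE lead_coef_eq0.
  have pE y : p.[y] = p`_1 * (y - - p`_0 / p`_1).
    rewrite horner_coef sp !big_ord_recl big_ord0 /=; field; exact: lp0.
  exists (- p`_0 / p`_1); last by rewrite rootE pE subrr mulr0.
  move: pab; rewrite !pE; set x := _ / _; rewrite mulrACA -expr2.
  rewrite pmulr_rlt0 ?exprn_even_gt0 //; nra.
have [irr|] := pselect (irreducible_poly p); last first.
  move=> /not_andP[//|/existsNP[q /not_implyP[q1 /not_implyP[qp pq]]]].
  have [r pE] : exists r, p = r * q by apply/dvdpP.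
  have q0 : q != 0 by apply: contra_neq p0 => q0; rewrite pE q0 mulr0.
  have r0 : r != 0 by apply: contra_neq p0 => r0; rewrite pE r0 mul0r.
  have qp_size : (size q < size p)%N.
    by rewrite ltn_neqAle dvdp_size_eqp // dvdp_leq // andbT; apply/negP.
  have size_pE := size_mul r0 q0; rewrite -pE in size_pE.
  have q1' : (1 < size q)%N.
    by rewrite ltn_neqAle eq_sym q1 /= lt0n size_poly_eq0.
  have root_p x : root r x || root q x -> root p x by rewrite pE rootM.
  have rn : (size r <= n)%N.
    by move: size_pE q1' pn => ->; move: (size r) (size q) => k l; lia.
  have qn : (size q <= n)%N by rewrite -ltnS (leq_trans qp_size).
  have [rab|rab] := ltP (r.[a] * r.[b]) 0.
    by have [x ax rx] := IH r rn ab rab; exists x; rewrite // root_p ?rx.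
  have [|x ax qx] := IH q qn ab _; last by exists x; rewrite // root_p ?qx ?orbT.
  rewrite ltNge; apply: contraTN pab => qab.
  by rewrite -leNgt pE !hornerM mulrACA mulr_ge0.
exfalso.
have [alpha p_alpha] : exists alpha, root (map_poly val p) alpha.
  by apply/closed_rootP; rewrite size_map_poly; case: (size p) p2 => [|[]].
have [q wq /esym qE] := irr_cone_ext_N1 irr p_alpha p2.
have [r wr /andP[qr rs]] := wsos_mod p1 wq.
have /dvdpP[h hE] : p %| 1 + r.
  have -> : 1 + r = (1 + q) - (q - r) by ring.
  rewrite dvdp_sub //; apply: (irr_ev_eq0 irr p_alpha).
  by rewrite rmorphD rmorph1 hornerD hornerC qE subrr.
have r1_gt0 x : 0 < (1 + r).[x].
  by rewrite hornerD hornerC ltr_wpDr ?ltr01 // wsos_ge0.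
have hp x : 0 < h.[x] * p.[x] by rewrite -hornerM -hE.
have h0 : h != 0.
  by apply: contraTneq (hp a) => ->; rewrite horner0 mul0r ltxx.
have hsize : (size h <= n)%N.
  have : (size (1 + r)%R < (size p).-1.*2)%N.
    rewrite (leq_ltn_trans (size_polyD _ _)) // gtn_max rs andbT size_poly1.
    by move: p1; move: (size p) => k; lia.
  by rewrite hE size_mul //; move: pn; move: (size p) (size h) => k l; lia.
have [|x _ /rootP hx] := IH h hsize ab.
  exact: mul_lt0_transfer (hp a) (hp b) pab.
by have := hp x; rewrite hx mul0r ltxx.
Qed.

Lemma max_cone_ivt : Num.real_closed_axiom F.
Proof.
move=> p a b ab /andP[pa pb].
have [a0|a0] := eqVneq p.[a] 0; first by exists a; rewrite ?lexx //; apply/rootP.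
have [b0|b0] := eqVneq p.[b] 0; first by exists b; rewrite ?lexx ?andbT //; apply/rootP.
have lt_ab : a < b.
  rewrite lt_neqAle ab andbT; apply: contra_neq a0 => E.
  by apply: le_anti; rewrite pa E pb.
have [|x /andP[ax xb] px] := max_cone_root_sign (leqnn (size p)) lt_ab.
  by rewrite nmulr_rlt0 lt_neqAle ?a0 // eq_sym b0.
by exists x; rewrite // !ltW.
Qed.

End MaximalCone.

(** * Existence of maximal field cones *)

Section FieldConeClosure.
Variable Omega : closedFieldType.

Lemma field_cone_bigcup (F : set (set Omega)) :
  F !=set0 -> F `<=` @field_cone Omega -> total_on F subset ->
  field_cone (\bigcup_(X in F) X).
Proof.
move=> [X0 FX0] FP Ftot.
have common x y : (\bigcup_(X in F) X) x -> (\bigcup_(X in F) X) y ->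
    exists X, [/\ F X, X x & X y].
  move=> [X FX Xx] [Y FY Yy]; case: (Ftot X Y FX FY) => XY.
    by exists Y; split=> //; apply: XY.
  by exists X; split=> //; apply: XY.
split.
- move=> x y Fx Fy; have [X [FX Xx Xy]] := common x y Fx Fy; exists X => //.
  exact: fconeD (FP _ FX) _ _ _ _.
- move=> x y Fx Fy; have [X [FX Xx Xy]] := common x y Fx Fy; exists X => //.
  exact: fconeM (FP _ FX) _ _ _ _.
- by move=> x [X FX Xx]; exists X => //; apply: fconeV (FP _ FX) _ _.
- move=> x y Fx Fy; have [X [FX Xx Xy]] := common x y Fx Fy; exists X => //.
  exact: fcone_sqrB (FP _ FX) _ _ _ _.
- by exists X0 => //; apply: fcone1 (FP _ FX0).
- by move=> [X FX]; apply: fconeN1 (FP _ FX).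
Qed.

(** Since [x] and [y] are in [T], adjoining [a = x - y] creates no new differences, hence no new
    squares to include. So [B] can fail to be a field cone only through [-1 = s + a * t], and then
    [y - x = (1 + s) / t] is in [T]. *)
Lemma max_field_cone_total (T : set Omega) : field_cone T ->
  (forall B, T `<=` B -> field_cone B -> B `<=` T) ->
  forall x y, T x -> T y -> T (x - y) \/ T (y - x).
Proof.
move=> coneT Tmax x y Tx Ty; apply: contrapT => /not_orP[nxy nyx].
have [TD TM TV Tsq T1 TN1] := coneT.
have T0 : T 0 by have := Tsq _ _ T1 T1; rewrite subrr expr0n.
set a := x - y.
pose B : set Omega := [set z | exists s t, [/\ T s, T t & z = s + a * t]].
apply: nxy; apply: (Tmax B).
- by move=> z Tz; exists z, 0; rewrite mulr0 addr0.
- have Bdiff z w : B z -> B w -> exists u v, [/\ T u, T v & z - w = u - v].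
    move=> [s [t [Ts Tt ->]]] [s' [t' [Ts' Tt' ->]]].
    exists (s + x * t + y * t'), (s' + x * t' + y * t).
    by split; [do ?[apply: (TD)|apply: (TM)]|do ?[apply: (TD)|apply: (TM)]
      |rewrite /a; ring].
  have Bsq z w : B z -> B w -> B ((z - w) ^+ 2).
    move=> /Bdiff/[apply] -[u [v [Tu Tv ->]]].
    by exists ((u - v) ^+ 2), 0; rewrite mulr0 addr0; split=> //; apply: Tsq.
  have BM z w : B z -> B w -> B (z * w).
    move=> [s [t [Ts Tt ->]]] [s' [t' [Ts' Tt' ->]]].
    exists (s * s' + a ^+ 2 * (t * t')), (s * t' + s' * t); rewrite /a.
    by split; [do ?[exact: (Tsq)|apply: (TD)|apply: (TM)]
      |do ?[apply: (TD)|apply: (TM)]|ring].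
  have B0 : B 0 by exists 0, 0; rewrite mulr0 addr0.
  split=> //.
  + move=> z w [s [t [Ts Tt ->]]] [s' [t' [Ts' Tt' ->]]].
    by exists (s + s'), (t + t'); split; [apply: (TD)|apply: (TD)|ring].
  + move=> z Bz; have [->|z0] := eqVneq z 0; first by rewrite invr0.
    have -> : z^-1 = z * (z ^+ 2)^-1 by field.
    apply: BM => //; exists (z ^+ 2)^-1, 0; rewrite mulr0 addr0; split=> //.
    apply: TV; have [u [v [Tu Tv]]] := Bdiff _ _ Bz B0; rewrite subr0 => ->.
    exact: Tsq.
  + by exists 1, 0; rewrite mulr0 addr0.
  + move=> [s [t [Ts Tt E]]].
    have [t0|t0] := eqVneq t 0; first by apply: TN1; rewrite E t0 mulr0 addr0.
    apply: nyx; have -> : y - x = (1 + s) * t^-1.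
      apply: (mulIf t0); rewrite mulfVK // -[1]opprK E /a; ring.
    by apply: (TM); [apply: TD|apply: TV].
- by exists 0, 1; rewrite mulr1 add0r.
Qed.

Lemma field_cone_extends (T0 : set Omega) : field_cone T0 ->
  exists (T : total_cone Omega), T0 `<=` T /\ Num.real_closed_axiom (cone_field T).
Proof.
move=> coneT0.
have [|F F0 FP Ftot|T [T0T coneT Tmax]] := @Zorn_above Omega (@field_cone _) T0.
- exact: coneT0.
- exact: field_cone_bigcup.
pose T' := TotalCone coneT (max_field_cone_total coneT Tmax).
by exists T'; split=> //; apply: max_cone_ivt.
Qed.

End FieldConeClosure.

(** * From an ordering of a ring to a point over a real closed field *)

Section OrderedPoint.
Variables (A : comNzRingType) (Omega : closedFieldType).
Variables (iota : {rmorphism A -> Omega}) (P : set A).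
Hypotheses (coneP : precone P) (Ptot : forall a, P a \/ P (- a)).
Hypothesis iota_eq0 : forall a, iota a = 0 <-> P a /\ P (- a).

Lemma field_cone_of_precone : field_cone
  [set x | exists a b, [/\ P a, P b, iota b != 0 & x = iota a / iota b]].
Proof.
have [PD PM Psq] := coneP; have P1 := precone1 coneP; have P0 := precone0 coneP.
have i10 : iota 1 != 0 by rewrite rmorph1 oner_neq0.
split.
- move=> _ _ [a [b [Pa Pb b0 ->]]] [c [d [Pc Pd d0 ->]]].
  exists (a * d + c * b), (b * d).
  split; [by do ?[apply: (PD)|apply: (PM)]|exact: PM| |].
    by rewrite rmorphM mulf_neq0.
  by rewrite rmorphD !rmorphM; field; rewrite b0 d0.
- move=> _ _ [a [b [Pa Pb b0 ->]]] [c [d [Pc Pd d0 ->]]].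
  exists (a * c), (b * d); split; [exact: PM|exact: PM| |].
    by rewrite rmorphM mulf_neq0.
  by rewrite !rmorphM; field; rewrite b0 d0.
- move=> _ [a [b [Pa Pb b0 ->]]]; have [a0|a0] := eqVneq (iota a) 0.
    by exists 0, 1; rewrite a0 rmorph0 !mul0r invr0.
  by exists b, a; rewrite invf_div.
- move=> _ _ [a [b [Pa Pb b0 ->]]] [c [d [Pc Pd d0 ->]]].
  exists ((a * d - c * b) ^+ 2), ((b * d) ^+ 2).
  split; [exact: Psq|exact: Psq| |].
    by rewrite rmorphXn rmorphM expf_neq0 // mulf_neq0.
  by rewrite !(rmorphXn, rmorphB, rmorphM); field; rewrite b0 d0.
- by exists 1, 1; rewrite divff.
- move=> [a [b [Pa Pb b0 E]]]; case/eqP: (b0); apply/iota_eq0; split=> //.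
  (* From [-1 = a / b], the sum [a + b] is in the support of [P], and then so is [b], against
     [b0]. *)
  have /iota_eq0[_ Nab] : iota (a + b) = 0.
    by rewrite rmorphD -[iota a](mulfVK b0) -E mulN1r addNr.
  have -> : - b = - (a + b) + a by ring.
  exact: PD.
Qed.

Lemma ordered_point : exists (K : rcfType) (theta : {rmorphism A -> K}),
  (forall a, P a -> 0 <= theta a) /\ (forall a, theta a = 0 -> P (- a)).
Proof.
have [T [PT ivt]] := field_cone_extends field_cone_of_precone.
have TP a : P a -> T (iota a).
  move=> Pa; apply: PT; exists a, 1; rewrite rmorph1 divr1 oner_neq0.
  by split=> //; apply: precone1.
have iotaT a : iota a \in cone_pred T.
  apply/cone_predP; case: (Ptot a) => /TP; first by left.
  by rewrite rmorphN; right.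
pose K : rcfType := HB.pack (cone_field T) (Num.RealField_isClosed.Build _ ivt).
pose theta a : cone_field T := ConeField (iotaT a).
have thetaB : zmod_morphism theta.
  by move=> a b; apply: val_inj; rewrite /= rmorphB.
have thetaM : monoid_morphism theta.
  by split=> [|a b]; apply: val_inj; rewrite /= ?rmorph1 ?rmorphM.
pose thetaR : {rmorphism A -> K} := HB.pack (theta : A -> K)
  (GRing.isZmodMorphism.Build A K theta thetaB)
  (GRing.isMonoidMorphism.Build A K theta thetaM).
exists K, thetaR; split=> a.
  by move=> /TP Ta; apply/(@cone_ge0P _ T (theta a)).
by move=> /(congr1 (val : cone_field T -> Omega)); rewrite rmorph0 => /iota_eq0[].
Qed.

End OrderedPoint.

(** Countability is carried as a bare injection into [nat], which passes to quotients and fractions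
    through [repr]. A countable structure is built only on the fraction field, where
    [countable_algebraic_closure] asks for one. *)
Lemma countable_idomain_embedding (D : idomainType) (pk : D -> nat) :
  injective pk ->
  exists (Omega : closedFieldType) (iota : {rmorphism D -> Omega}), injective iota.
Proof.
move=> pk_inj.
pose pkF (x : {fraction D}) : nat :=
  pickle (pk (frac (repr x)).1, pk (frac (repr x)).2).
have pkF_inj : injective pkF.
  move=> x y /(pcan_inj pickleK) [/pk_inj E1 /pk_inj E2].
  by apply: (can_inj reprK); apply: val_inj; apply: injective_projections.
pose unpkF (n : nat) : option {fraction D} :=
  if pselect (exists x, pkF x = n) is left h then Some (sval (cid h)) else None.
have pkFK : pcancel pkF unpkF.
  move=> x; rewrite /unpkF; case: pselect => [h|[]]; last by exists x.
  by case: (cid h) => y /= /pkF_inj ->.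
pose F : countFieldType := HB.pack {fraction D}
  (isCountable.Build {fraction D} pkFK).
have [Omega [phi _]] := countable_algebraic_closure F.
exists Omega, (phi \o @tofrac D)%FUN => x y /fmorph_inj /eqP.
by rewrite tofrac_eq => /eqP.
Qed.

Lemma countable_unit_domain_embedding (D : comUnitRingType) (pk : D -> nat) :
  injective pk -> (forall x y : D, x * y = 0 -> (x == 0) || (y == 0)) ->
  exists (Omega : closedFieldType) (iota : {rmorphism D -> Omega}), injective iota.
Proof.
move=> pk_inj dom.
pose D' : idomainType := HB.pack D (GRing.ComUnitRing_isIntegral.Build D dom).
exact (@countable_idomain_embedding D' pk pk_inj).
Qed.

Section ResidueField.
Variable D : comNzRingType.

(** A quotient by a prime ideal comes only as a commutative ring; inverses picked by choice supply
    the unit ring structure on which an [idomainType] is built. *)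
Let unitD : {pred D} := fun x => `[< exists y, y * x = 1 >].
Let invD (x : D) : D :=
  if pselect (exists y, y * x = 1) is left ex_inv then sval (cid ex_inv) else x.

Let invDl : {in unitD, left_inverse 1 invD *%R}.
Proof.
by move=> x /asboolP ux; rewrite /invD; case: pselect => // h; case: (cid h).
Qed.

Let unitDP (x y : D) : y * x = 1 -> unitD x.
Proof. by move=> yx; apply/asboolP; exists y. Qed.

Let invD_out : {in [predC unitD], invD =1 id}.
Proof. by move=> x /asboolP ux; rewrite /invD; case: pselect. Qed.

Lemma countable_domain_embedding (pk : D -> nat) : injective pk ->
  (forall x y : D, x * y = 0 -> (x == 0) || (y == 0)) ->
  exists (Omega : closedFieldType) (iota : {rmorphism D -> Omega}), injective iota.
Proof.
move=> pk_inj dom.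
pose D' : comUnitRingType := HB.pack D
  (GRing.ComNzRing_hasMulInverse.Build D invDl unitDP invD_out).
exact (@countable_unit_domain_embedding D' pk pk_inj dom).
Qed.

End ResidueField.

Section PrimeIdeal.
Local Open Scope quotient_scope.

Lemma prime_ideal_residue (A : comNzRingType) (pk : A -> nat) (I : set A) :
  injective pk -> I 0 -> ~ I 1 ->
  (forall x y, I x -> I y -> I (x - y)) -> (forall a x, I x -> I (a * x)) ->
  (forall x y, I (x * y) -> I x \/ I y) ->
  exists (Omega : closedFieldType) (iota : {rmorphism A -> Omega}),
    forall a, iota a = 0 <-> I a.
Proof.
move=> pk_inj I0 I1 IB IM Iprime.
pose S : pred A := fun x => `[< I x >].
have Szmod : zmod_closed S.
  split; first exact/asboolP.
  by move=> x y /asboolP Ix /asboolP Iy; apply/asboolP/IB.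
have Sprop : 1 \notin S /\ forall a, {in S, forall u, a * u \in S}.
  split; first by apply/negP => /asboolP.
  by move=> a x /asboolP Ix; apply/asboolP/IM.
have Sprime : prime_idealr_closed S.
  move=> x y /asboolP/Iprime[Ix|Iy]; apply/orP; [left|right]; exact/asboolP.
pose J : prime_idealr A := HB.pack S (GRing.isZmodClosed.Build A S Szmod)
  (isProperIdeal.Build A S Sprop)
  (isPrimeIdealrClosed.Build A S Sprime).
have [|x y xy|Omega [phi phi_inj]] :=
    @countable_domain_embedding {ideal_quot J} (fun x => pk (repr x)).
- by apply: inj_comp => //; apply: can_inj reprK.
- exact: (@Quotient.rquot_IdomainAxiom A J).
exists Omega, (phi \o \pi_{ideal_quot J})%FUN => a /=; split.
  rewrite -(rmorph0 phi) => /phi_inj/eqP.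
  by rewrite -(rmorph0 \pi_{ideal_quot J}) -Quotient.idealrBE subr0 => /asboolP.
move=> Ia; suff -> : \pi_{ideal_quot J} a = 0 by rewrite rmorph0.
apply/eqP; rewrite -(rmorph0 \pi_{ideal_quot J}) -Quotient.idealrBE subr0.
exact/asboolP.
Qed.

End PrimeIdeal.

(** An abstract Positivstellensatz. An element killed by [theta] has its opposite in the maximal
    cone [P], which is impossible for an element of [U]. *)
Theorem precone_real_point (A : comNzRingType) (pk : A -> nat) (T U : set A) :
  injective pk -> precone T -> U 1 -> (forall u v, U u -> U v -> U (u * v)) ->
  U `<=` T -> (forall u, U u -> ~ T (- u)) ->
  exists (K : rcfType) (theta : {rmorphism A -> K}),
    (forall a, T a -> 0 <= theta a) /\ (forall u, U u -> theta u != 0).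
Proof.
move=> pk_inj coneT U1 UM UT TU.
have [P [TP coneP PU Ptot Pprime]] := max_precone coneT U1 UM UT TU.
have [PD PM _] := coneP; have P0 := precone0 coneP.
pose I : set A := [set a | P a /\ P (- a)].
have IN x : I x -> I (- x) by rewrite /I /= opprK; tauto.
have IB x y : I x -> I y -> I (x - y).
  move=> [Px Nx] [Py Ny]; split; first exact: PD.
  by rewrite opprB addrC; apply: PD.
have IM a x : I x -> I (a * x).
  move=> [Px Nx]; case: (Ptot a) => Pa.
    by split; rewrite -?mulrN; apply: PM.
  by rewrite -[a]opprK mulNr -mulrN; split; rewrite -?mulrN; apply: PM; rewrite ?opprK.
have Iprime x y : I (x * y) -> I x \/ I y by move=> [Pxy Nxy]; apply: Pprime.
have I0 : I 0 by split; rewrite ?oppr0.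
have I1 : ~ I 1 by move=> [_]; apply: PU.
have [Omega [iota iotaE]] := prime_ideal_residue pk_inj I0 I1 IB IM Iprime.
have [K [theta [thetaP theta0]]] := ordered_point coneP Ptot iotaE.
exists K, theta; split=> [a Ta|u Uu]; first exact/thetaP/TP.
by apply/eqP => /theta0; apply: PU.
Qed.

(** * The real Nullstellensatz *)

Section Ideals.
Variables (R : realType) (N : nat).
Implicit Types (P : set {mpoly R[N]}) (p q a : {mpoly R[N]}).

Lemma ideal_gen_mem P p : P p -> ideal_gen P p.
Proof.
move=> Pp; exists [:: (1, p)]; rewrite big_seq1 mul1r; split=> // c.
by rewrite inE => /eqP->.
Qed.

Lemma ideal_gen0 P : ideal_gen P 0.
Proof. by exists [::]; rewrite big_nil; split. Qed.

Lemma ideal_genD P p q : ideal_gen P p -> ideal_gen P q -> ideal_gen P (p + q).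
Proof.
move=> [s [sP ->]] [s' [s'P ->]]; exists (s ++ s'); rewrite big_cat; split=> // c.
by rewrite mem_cat => /orP[/sP|/s'P].
Qed.

Lemma ideal_genM P a p : ideal_gen P p -> ideal_gen P (a * p).
Proof.
move=> [s [sP ->]]; exists [seq (a * c.1, c.2) | c <- s]; split.
  by move=> _ /mapP[c /sP Pc ->].
by rewrite big_map mulr_sumr; apply: eq_bigr => c _; rewrite mulrA.
Qed.

Lemma ideal_genB P p q : ideal_gen P p -> ideal_gen P q -> ideal_gen P (p - q).
Proof.
by move=> Pp Pq; apply: ideal_genD => //; rewrite -mulN1r; apply: ideal_genM.
Qed.

Lemma ideal_gen_zero P p x : ideal_gen P p -> zero_set P x -> p.@[x] = 0.
Proof.
move=> [s [sP ->]] Px; rewrite (big_morph _ (mevalD x) (meval0 x)).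
rewrite big_seq big1 // => c /sP Pc.
by rewrite mevalM (Px _ Pc) mulr0.
Qed.

Lemma sos_sqr a : @sums_of_squares R N (a ^+ 2).
Proof. by exists [:: a]; rewrite big_seq1. Qed.

Lemma sosD p q : sums_of_squares p -> sums_of_squares q -> sums_of_squares (p + q).
Proof. by move=> [s ->] [s' ->]; exists (s ++ s'); rewrite big_cat. Qed.

Lemma sosM p q : sums_of_squares p -> sums_of_squares q -> sums_of_squares (p * q).
Proof.
move=> [s ->] [s' ->]; exists [seq c.1 * c.2 | c <- [seq (a, b) | a <- s, b <- s']].
rewrite big_map big_allpairs mulr_suml; apply: eq_bigr => a _.
by rewrite mulr_sumr; apply: eq_bigr => b _; rewrite exprMn.
Qed.

Lemma sos_ge0 p x : sums_of_squares p -> 0 <= p.@[x].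
Proof.
move=> [s ->]; rewrite (big_morph _ (mevalD x) (meval0 x)); apply: sumr_ge0 => a _.
by rewrite expr2 mevalM -expr2 sqr_ge0.
Qed.

Lemma real_radical_zero P p x :
  real_radical (ideal_gen P) p -> zero_set P x -> p.@[x] = 0.
Proof.
move=> [k [a [q [sa qP E]]]] Px; apply/eqP.
have : p.@[x] ^+ (2 * k) <= 0.
  rewrite -oppr_ge0 -(rmorphXn (meval x)) -mevalN E mevalD (ideal_gen_zero qP Px) addr0.
  exact: sos_ge0.
(* For [k = 0] the power is 1; [expf_eq0] includes the positivity of the exponent, which disposes of
   this case. *)
rewrite le_eqVlt ltNge exprM exprn_ge0 ?sqr_ge0 // orbF.
by rewrite -exprM expf_eq0 => /andP[].
Qed.

End Ideals.

(** * Rational polynomials as terms and as countable data *)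

Import MapFormula.

Definition term_represents n (p : {mpoly rat[n]}) (t : qe_rcf.term rat) : Prop :=
  forall (K : rcfType) (e : seq K), qval e t = mmap ratr (fun i : 'I_n => e`_i) p.

Lemma term_of_mpoly n (p : {mpoly rat[n]}) : exists t, term_represents p t.
Proof.
pose rep (r : {mpoly rat[n]}) := exists t, term_represents r t.
have repC c : rep c%:MP by exists (qe_rcf.Const c) => K e; rewrite mmapC.
have repX i : rep 'X_i.
  by exists (qe_rcf.Var _ i) => K e; rewrite mmapX mmap1U.
have repD r r' : rep r -> rep r' -> rep (r + r').
  by move=> [t tE] [u uE]; exists (qe_rcf.Add t u) => K e; rewrite mmapD -tE -uE.
have repM r r' : rep r -> rep r' -> rep (r * r').
  move=> [t tE] [u uE]; exists (qe_rcf.Mul t u) => K e.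
  by transitivity (qval e t * qval e u); rewrite // tE uE (rmorphM (mmap _ _)).
have repXn k r : rep r -> rep (r ^+ k).
  move=> repr; elim: k => [|k IH]; first exact: (repC 1).
  by rewrite exprS; apply: repM.
suff : rep p by [].
rewrite [p]mpolyE; apply: (big_ind rep) => //; first exact: (repC 0).
move=> m _; rewrite -mul_mpolyC; apply: (repM) => //.
rewrite mpolyXE_id; apply: (big_ind rep) => //; first exact: (repC 1).
by move=> i _; apply: repXn.
Qed.

(** A variable of index at least [M] becomes 0, the default value read past the end of an assignment
    of length [M]. *)
Fixpoint mpoly_of_term (M N : nat) (t : qe_rcf.term rat) : {mpoly rat[M + N]} :=
  match t with
  | qe_rcf.Var i => if insub i is Some j then 'X_(lshift N j) else 0
  | qe_rcf.Const r => r%:MP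
  | qe_rcf.NatConst k => k%:R
  | qe_rcf.Add u v => mpoly_of_term M N u + mpoly_of_term M N v
  | qe_rcf.Opp u => - mpoly_of_term M N u
  | qe_rcf.NatMul u k => mpoly_of_term M N u *+ k
  | qe_rcf.Mul u v => mpoly_of_term M N u * mpoly_of_term M N v
  | qe_rcf.Exp u k => mpoly_of_term M N u ^+ k
  end.

(** Serves both for [spec], with [j] the embedding of constants, and for the point [theta] over [K],
    with [j] the identity. *)
Lemma mpoly_of_termE (M N : nat) (K : rcfType) (S : comNzRingType)
    (j : {rmorphism K -> S}) (theta : {rmorphism {mpoly rat[M + N]} -> S})
    (e : seq K) t :
  size e = M -> (forall r, theta r%:MP = j (ratr r)) ->
  (forall i : 'I_M, theta 'X_(lshift N i) = j e`_i) ->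
  theta (mpoly_of_term M N t) = j (qval e t).
Proof.
move=> eM thetaC thetaX; rewrite /qval.
elim: t => /= [i|r|k|u IHu v IHv|u IHu|u IHu k|u IHu v IHv|u IHu k].
- case: insubP => [i' _ <-|]; first exact: thetaX.
  by rewrite -leqNgt => iM; rewrite nth_default ?eM // !rmorph0.
- exact: thetaC.
- by rewrite !rmorph_nat.
- by rewrite !rmorphD IHu IHv.
- by rewrite !rmorphN IHu.
- by rewrite !rmorphMn IHu.
- by rewrite !rmorphM IHu IHv.
- by rewrite !rmorphXn IHu.
Qed.

Definition mpoly_code n (p : {mpoly rat[n]}) : nat :=
  pickle [seq (multinom_val m, p@_m) | m <- msupp p].

Lemma mpoly_code_inj n : injective (@mpoly_code n).
Proof.
move=> p q /(pcan_inj pickleK) E.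
have decode (r : {mpoly rat[n]}) : r = \sum_(c <- [seq (multinom_val m, r@_m)
    | m <- msupp r]) c.2 *: 'X_[Multinom c.1].
  by rewrite big_map {1}[r]mpolyE; apply: eq_bigr => -[m] _.
by rewrite [p]decode [q]decode E.
Qed.

Lemma rmorph_mmap n (S : comNzRingType) (K : comNzRingType)
    (theta : {rmorphism {mpoly K[n]} -> S}) (f : K -> S) (v : 'I_n -> S) p :
  (forall r, theta r%:MP = f r) -> (forall i, theta 'X_i = v i) ->
  theta p = mmap f v p.
Proof.
move=> thetaC thetaX; rewrite {1}[p]mpolyE /mmap rmorph_sum.
apply: eq_bigr => m _; rewrite -mul_mpolyC rmorphM mpolyXE_id rmorph_prod thetaC.
by congr (_ * _); apply: eq_bigr => i _; rewrite rmorphXn thetaX.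
Qed.

(** * Lifting real polynomials to rational ones, and the Nullstellensatz *)

Section RealNullstellensatz.
Variables (R : realType) (N : nat).
Implicit Types (p q : {mpoly R[N]}).

Section Lift.
Variable c : seq R.
Let M := size c.

(* [spec] sends the first [M] variables to the real coefficients listed in [c]. *)
Definition spec_var (i : 'I_(M + N)) : {mpoly R[N]} :=
  match split i with inl j => (c`_j)%:MP | inr k => 'X_k end.

Definition spec : {mpoly rat[M + N]} -> {mpoly R[N]} :=
  mmap (@mpolyC N R \o ratr) spec_var.

HB.instance Definition _ := GRing.RMorphism.on spec.

Lemma specC r : spec r%:MP = (ratr r)%:MP.
Proof. exact: mmapC. Qed.

Lemma specN a : spec (- a) = - spec a. Proof. exact: rmorphN. Qed.
Lemma specD a b : spec (a + b) = spec a + spec b. Proof. exact: rmorphD. Qed.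
Lemma specM a b : spec (a * b) = spec a * spec b. Proof. exact: rmorphM. Qed.
Lemma specXn a k : spec (a ^+ k) = spec a ^+ k. Proof. exact: rmorphXn. Qed.

Lemma spec_lshift j : spec 'X_(lshift N j) = (c`_j)%:MP.
Proof. by rewrite /spec mmapX mmap1U /spec_var (unsplitK (inl _ j)). Qed.

Lemma spec_rshift k : spec 'X_(rshift M k) = 'X_k.
Proof. by rewrite /spec mmapX mmap1U /spec_var (unsplitK (inr _ k)). Qed.

Lemma spec_term t : spec (mpoly_of_term M N t) = (qval c t)%:MP.
Proof. exact: mpoly_of_termE erefl specC spec_lshift. Qed.

Lemma spec_meval (a : {mpoly rat[M + N]}) (x : seq R) : size x = N ->
  (spec a).@[fun i => x`_i] = mmap ratr (fun i : 'I_(M + N) => (c ++ x)`_i) a.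
Proof.
move=> xN; apply: (rmorph_mmap (theta := meval _ \o spec)) => [r|i] /=.
  by rewrite specC mevalC.
rewrite nth_cat -/M; case: (split_ordP i) => j ->.
  by rewrite spec_lshift mevalC.
by rewrite spec_rshift mevalXU /= addKn.
Qed.

Lemma spec_lift p : {subset [seq p@_m | m <- msupp p] <= c} ->
  exists a, spec a = p.
Proof.
move=> pc.
pose img q := exists a, spec a = q.
have imgD q q' : img q -> img q' -> img (q + q').
  by move=> [a <-] [b <-]; exists (a + b); rewrite rmorphD.
have imgM q q' : img q -> img q' -> img (q * q').
  by move=> [a <-] [b <-]; exists (a * b); rewrite rmorphM.
have imgX k r : img r -> img (r ^+ k).
  by move=> [a <-]; exists (a ^+ k); rewrite rmorphXn.
suff : img p by [].
rewrite [p]mpolyE big_seq; apply: (big_ind img) => //.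
  by exists 0; rewrite rmorph0.
move=> m mp; rewrite -mul_mpolyC; apply: (imgM).
  have /pc cm : p@_m \in [seq p@_m | m <- msupp p] by apply/mapP; exists m.
  have im : (index p@_m c < M)%N by rewrite index_mem.
  by exists ('X_(lshift N (Ordinal im))); rewrite spec_lshift /= nth_index.
rewrite mpolyXE_id; apply: (big_ind img) => //; first by exists 1; rewrite rmorph1.
by move=> i _; apply: imgX; exists ('X_(rshift M i)); rewrite spec_rshift.
Qed.

End Lift.
Arguments spec c a : clear implicits.

Lemma qsat_eq0 (K : rcfType) (e : seq K) (ts : seq (qe_rcf.term rat)) f :
  qsat e (foldr (fun t => qe_rcf.And (qe_rcf.Equal t (qe_rcf.Const 0))) f ts) =
  all (fun t => qval e t == 0) ts && qsat e f.
Proof.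
elim: ts => //= t ts IH; rewrite -andbA -IH -[LHS]/(_ && _); congr andb.
by rewrite -[LHS]/(qval e t == qval e (qe_rcf.Const 0)) {2}/qval /= rmorph0.
Qed.

Theorem real_nullstellensatz (s : seq {mpoly R[N]}) q :
  (forall x, zero_set [set` s] x -> q.@[x] = 0) ->
  real_radical (ideal_gen [set` s]) q.
Proof.
move=> q_zero; apply: contrapT => nrad.
set I := ideal_gen [set` s] in nrad.
pose c := flatten [seq [seq p@_m | m <- msupp p] | p <- q :: s].
have lift p : p \in q :: s -> exists a, spec c a = p.
  move=> ps; apply: spec_lift => r rp; apply/flattenP.
  by exists [seq p@_m | m <- msupp p] => //; apply/mapP; exists p.
have [Q QE] := lift q (mem_head _ _).
(* The squares in [sig] may have arbitrary real coefficients. Hence every [a] that specializes to a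
   nonnegative constant is in [T], which fixes the signs of the lifted coefficients in [K]. *)
pose T := [set a | exists sig i, [/\ sums_of_squares sig, I i & spec c a = sig + i]].
pose U := [set a | exists k, a = Q ^+ (2 * k)].
have coneT : precone T.
  split=> [a b|a b|a].
  - move=> [sig [i [Ss Ii E]]] [sig' [i' [Ss' Ii' E']]].
    exists (sig + sig'), (i + i'); split; [exact: sosD|exact: ideal_genD|].
    by rewrite specD E E' addrACA.
  - move=> [sig [i [Ss Ii E]]] [sig' [i' [Ss' Ii' E']]].
    exists (sig * sig'), (sig * i' + (sig' + i') * i); split; first exact: sosM.
      by apply: ideal_genD; apply: ideal_genM.
    by rewrite specM E E'; ring.
  - exists (spec c a ^+ 2), 0; split; [exact: sos_sqr|exact: ideal_gen0|].
    by rewrite specXn addr0.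
have [||||K [theta [thetaT thetaU]]] :=
  precone_real_point (U := U) (@mpoly_code_inj _) coneT.
- by exists 0%N; rewrite muln0 expr0.
- by move=> _ _ [k ->] [l ->]; exists (k + l)%N; rewrite -exprD mulnDr.
- by move=> _ [k ->]; rewrite mulnC exprM; apply: (precone_sqr coneT).
- move=> _ [k ->] [sig [i [Ss Ii E]]]; apply: nrad; exists k, sig, i; split=> //.
  by rewrite -E specN specXn QE.
pose M := size c.
pose eK := [seq theta 'X_(lshift N j) | j <- enum 'I_M].
have eK_size : size eK = M by rewrite size_map size_enum_ord.
have nth_eK (j : 'I_M) : theta 'X_(lshift N j) = eK`_j.
  by rewrite (nth_map j) ?size_enum_ord // nth_ord_enum.
have thetaC r : theta r%:MP = ratr r.
  by have := fmorph_eq_rat (theta \o @mpolyC (M + N) rat) r.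
have theta_term t : theta (mpoly_of_term M N t) = qval eK t.
  exact (@mpoly_of_termE M N K K idfun theta eK t eK_size thetaC nth_eK).
have T_const a r : spec c a = r%:MP -> 0 <= r -> T a.
  move=> E r0; exists ((Num.sqrt r)%:MP ^+ 2), 0.
  split; [exact: sos_sqr|exact: ideal_gen0|].
  by rewrite addr0 E -rmorphXn sqr_sqrtr.
have sign_gt0 t : 0 < qval c t -> 0 < qval eK t.
  (* [theta] preserves only weak inequalities; a rational strictly between 0 and [qval c t] keeps
     the image away from 0. *)
  move=> t0; have [r] := rat_in_itvoo t0; rewrite in_itv /= => /andP[r0 rt].
  have : 0 <= theta (mpoly_of_term M N t - r%:MP).
    apply/thetaT/(T_const _ (qval c t - ratr r)); last by rewrite subr_ge0 ltW.
    by rewrite specD specN spec_term specC -rmorphB.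
  rewrite rmorphB thetaC theta_term subr_ge0; apply: lt_le_trans.
  by rewrite ltr0q -(ltr0q R).
have sign_eq t : (0 < qval eK t) = (0 < qval c t).
  apply/idP/idP; last exact: sign_gt0.
  apply: contraTT; rewrite -!leNgt -theta_term => t0.
  rewrite -oppr_ge0 -rmorphN; apply/thetaT/(T_const _ (- qval c t)).
    by rewrite specN spec_term -rmorphN.
  by rewrite oppr_ge0.
pose xK := [seq theta 'X_(rshift M k) | k <- enum 'I_N].
have xK_size : size xK = N by rewrite size_map size_enum_ord.
have theta_mmap a : theta a = mmap ratr (fun i : 'I_(M + N) => (eK ++ xK)`_i) a.
  apply: rmorph_mmap => // i; rewrite nth_cat eK_size.
  case: (split_ordP i) => j -> /=; first by rewrite nth_eK.
  by rewrite addKn (nth_map j) ?size_enum_ord // nth_ord_enum.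
have [Qt QtE] := term_of_mpoly Q.
have [ts [tsR tsK]] : exists ts : seq (qe_rcf.term rat),
    (forall x : seq R, size x = N ->
      all (fun t => qval (c ++ x) t == 0) ts = all (fun p => p.@[fun i => x`_i] == 0) s)
  /\ all (fun t => qval (eK ++ xK) t == 0) ts.
  have : {subset s <= s} by [].
  elim: {1 3}s => [|p s' IH] ss'; first by exists [::].
  have [|ts [tsR tsK]] := IH; first by move=> p' p's'; rewrite ss' // inE p's' orbT.
  have ps : p \in s by rewrite ss' ?mem_head.
  have [|a aE] := lift p; first by rewrite inE ps orbT.
  have [t tE] := term_of_mpoly a.
  exists (t :: ts); split=> [x xN|] /=.
    by rewrite tsR // tE -spec_meval // aE.
  (* Both [a] and [- a] specialize into [I], so both are in [T] and [theta a] is 0. *)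
  rewrite tsK andbT tE -theta_mmap eq_le -oppr_ge0 -rmorphN.
  have Ip : I p by apply: ideal_gen_mem.
  have T0 : @sums_of_squares R N 0 by have := @sos_sqr R N 0; rewrite expr0n.
  apply/andP; split; apply: thetaT; [exists 0, (- p)|exists 0, p];
    rewrite add0r ?specN aE; split=> //.
  by rewrite -mulN1r; apply: ideal_genM.
pose f := foldr (fun t => qe_rcf.And (qe_rcf.Equal t (qe_rcf.Const 0)))
  (qe_rcf.Not (qe_rcf.Equal Qt (qe_rcf.Const 0))) ts.
have sat_neq0 (L : rcfType) (e : seq L) :
    qsat e (qe_rcf.Not (qe_rcf.Equal Qt (qe_rcf.Const 0))) = (qval e Qt != 0).
  by rewrite -[LHS]/(qval e Qt != qval e (qe_rcf.Const 0)) {2}/qval /= rmorph0.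
(* The point [xK] solves the system over [K]. After elimination only the coefficients [eK] remain,
   and they can be exchanged for [c]. *)
have : qsat eK (elim_vars (size eK) N f).
  apply/qsat_elim_vars; exists xK; split=> //.
  rewrite qsat_eq0 tsK sat_neq0 QtE -theta_mmap.
  have : theta (Q ^+ (2 * 1)) != 0 by apply: thetaU; exists 1%N.
  by rewrite rmorphXn expf_eq0.
rewrite (qsat_transfer sign_eq) eK_size => /qsat_elim_vars[x [xN]].
rewrite qsat_eq0 tsR // sat_neq0 QtE -spec_meval // QE => /andP[/allP xs].
by rewrite q_zero ?eqxx // => p /xs /eqP.
Qed.

End RealNullstellensatz.

(** * Elimination *)

(** The property that makes a lexicographic order eliminate variables. Where they first differ [t1]
    is strictly smaller than [t2], which cannot happen at an index where [t2] is 0, so they agree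
    before the last index. *)
Lemma tuplelexi_le_last N (l : 'I_N) (t1 t2 : N.-tuplelexi nat) :
  (forall i : 'I_N, (i <= l)%N) -> (t1 <= t2)%O ->
  (forall i : 'I_N, i != l -> tnth t2 i = 0%N) ->
  (forall i : 'I_N, i != l -> tnth t1 i = 0%N) /\ (tnth t1 l <= tnth t2 l)%N.
Proof.
move=> lmax /lexi_tupleP[k t12] t20.
have t10 (i : 'I_N) : i != l -> (i <= k)%N -> tnth t1 i = 0%N /\ i != k :> nat.
  move=> il ik; have [] := t12 i ik; rewrite (t20 _ il) leEnat leqn0 => /eqP -> <-.
  by rewrite eqxx.
have lk : (l <= k)%N.
  rewrite leqNgt; apply/negP => kl.
  have kN : (k < N)%N := ltn_trans kl (ltn_ord l).
  by have [||_ /eqP] := t10 (Ordinal kN); rewrite // -val_eqE /= neq_ltn kl.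
split=> [i il|]; first by have [] := t10 i il (leq_trans (lmax i) lk).
by have [] := t12 l lk.
Qed.

Section LexLeading.
Variables (R : realType) (N : nat).
Implicit Types p : {mpoly R[N]}.

Lemma lex_lm_max p m : m \in msupp p ->
  ((multinom_val m : N.-tuplelexi nat) <= multinom_val (lex_lm p))%O.
Proof. by move=> mp; exact: (bigmax_sup_seq _ m xpredT). Qed.

Lemma lex_lm_mem p : p != 0 -> lex_lm p \in msupp p.
Proof.
rewrite -msupp_eq0 /lex_lm.
elim: (msupp p) => // m s IH _; rewrite big_cons inE.
have [->|s0] := eqVneq s [::].
  rewrite big_nil; case: m => m; case: leP => [|_]; last by rewrite eqxx.
  by rewrite lex0 => /eqP E; rewrite -E eqxx.
have := IH s0; case: m => m; case: leP => _ ms; first by rewrite ms orbT.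
by rewrite eqxx.
Qed.

(** A monomial of a sum occurs in some summand, and each summand is a multiple of a single leading
    term. *)
Lemma ideal_gen_monomial (P : set {mpoly R[N]}) p m :
  ideal_gen [set lex_lt q | q in P] p -> m \in msupp p ->
  exists q, [/\ P q, q != 0 & exists m', m = (lex_lm q + m')%MM].
Proof.
move=> [s [sP ->]]; rewrite mcoeff_msupp => ms.
have [c cs cm] : exists2 c, c \in s & (c.1 * c.2)@_m != 0.
  apply: contrapT => nex; move: ms.
  rewrite (raddf_sum (mcoeff m)) big_seq big1 ?eqxx //.
  move=> c cs; apply: contrapT => /eqP cm; apply: nex; by exists c.
have [q Pq qE] := sP c cs; exists q; split=> //.
  apply: contraNneq cm => q0; move: qE.
  by rewrite /lex_lt q0 mcoeff0 scale0r => <-; rewrite mulr0 mcoeff0.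
move: cm; rewrite -qE /lex_lt -scalerAr mcoeffZ mulf_eq0 negb_or => /andP[_].
rewrite -mcoeff_msupp (perm_mem (msuppMX _ _)) => /mapP[m' _ ->].
by exists m'.
Qed.

End LexLeading.

(** * Polynomials in the last variable *)

Section Elimination.
Variables (R : realType) (n m : nat).
Local Notation E := (n + m + 1)%N.
Let l : 'I_E := rshift (n + m) ord0.

Definition t_mon (k : nat) : 'X_{1..E} := (U_(l) *+ k)%MM.

Lemma t_mon_last k : t_mon k l = k.
Proof. by rewrite mulmnE mnm1E eqxx mul1n. Qed.

Lemma t_mon_other k i : i != l -> t_mon k i = 0%N.
Proof. by move=> il; rewrite mulmnE mnm1E eq_sym (negPf il). Qed.

Lemma t_monP (mon : 'X_{1..E}) :
  (forall i, i != l -> mon i = 0%N) -> mon = t_mon (mon l).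
Proof.
move=> mon0; apply/mnmP => i; have [->|il] := eqVneq i l.
  by rewrite t_mon_last.
by rewrite t_mon_other ?mon0.
Qed.

(** Polynomials in the last variable are represented in [{poly R}] for the sake of Euclidean
    division. *)
Definition poly_in_t (P : {poly R}) : {mpoly R[E]} :=
  (map_poly (@mpolyC E R) P).[var_t R n m].

Definition mpoly_of_poly (P : {poly R}) : {mpoly R[1]} :=
  (map_poly (@mpolyC 1 R) P).['X_ord0].

Lemma mcoeff_poly_in_t P mon : (poly_in_t P)@_mon =
  \sum_(i < size P) P`_i * (t_mon i == mon)%:R.
Proof.
rewrite /poly_in_t (horner_coef_wide _ (size_poly _ _)) (raddf_sum (mcoeff mon)).
apply: eq_bigr => i _; rewrite coef_map /= mul_mpolyC mcoeffZ.
by rewrite /var_t mpolyXn mcoeffX.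
Qed.

Lemma poly_in_t_mon P k : (poly_in_t P)@_(t_mon k) = P`_k.
Proof.
rewrite mcoeff_poly_in_t.
have tE i : (t_mon i == t_mon k) = (i == k).
  by apply/eqP/eqP => [/(congr1 (fun q : 'X_{1..E} => q l))|->//]; rewrite !t_mon_last.
have [kP|kP] := ltnP k (size P).
  rewrite (bigD1 (Ordinal kP)) //= tE eqxx mulr1 big1 ?addr0 // => i ik.
  by rewrite tE (_ : (_ == _) = false) ?mulr0 //; apply: negPf.
rewrite nth_default // big1 // => i _.
by rewrite tE ltn_eqF ?mulr0 // (leq_trans (ltn_ord i)).
Qed.

Lemma msupp_poly_in_t P mon : mon \in msupp (poly_in_t P) ->
  exists2 k, mon = t_mon k & P`_k != 0.
Proof.
rewrite mcoeff_msupp => monP.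
have [k kE] : exists k, mon = t_mon k.
  apply: contrapT => nex; move: monP; rewrite mcoeff_poly_in_t big1 ?eqxx // => i _.
  by rewrite (_ : (_ == _) = false) ?mulr0 //; apply/eqP => monE; apply: nex; exists i.
by exists k => //; rewrite -poly_in_t_mon -kE.
Qed.

Lemma poly_in_tB P Q : poly_in_t (P - Q) = poly_in_t P - poly_in_t Q.
Proof. by rewrite /poly_in_t rmorphB hornerD hornerN. Qed.

Lemma poly_in_tM P Q : poly_in_t (P * Q) = poly_in_t P * poly_in_t Q.
Proof. by rewrite /poly_in_t rmorphM hornerM. Qed.

Lemma embed_mpoly_of_poly P : embed_t n m (mpoly_of_poly P) = poly_in_t P.
Proof.
rewrite /embed_t /mpoly_of_poly -(horner_map (comp_mpoly _)) /=.
rewrite comp_mpolyXU -tnth_nth tnth_mktuple /poly_in_t -map_poly_comp.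
by congr (_.[_]); apply: eq_map_poly => r /=; rewrite comp_mpolyC.
Qed.

Lemma mpoly_of_poly_eval P (z : 'I_1 -> R) : (mpoly_of_poly P).@[z] = P.[z ord0].
Proof.
rewrite /mpoly_of_poly -(horner_map (meval z)) /= mevalXU -map_poly_comp.
by rewrite map_poly_id // => r _ /=; rewrite mevalC.
Qed.

Lemma mpoly_of_poly_onto (q : {mpoly R[1]}) : exists P, q = mpoly_of_poly P.
Proof.
exists (\sum_(mon <- msupp q) q@_mon *: 'X^(mon ord0)).
rewrite {1}[q]mpolyE /mpoly_of_poly rmorph_sum horner_sum; apply: eq_bigr => mon _.
rewrite -mul_polyC rmorphM /= map_polyC map_polyXn hornerM hornerC hornerXn.
by rewrite mul_mpolyC mpolyXE_id big_ord1.
Qed.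

Lemma poly_in_t_onto (p : {mpoly R[E]}) :
  (forall mon, mon \in msupp p -> forall i, i != l -> mon i = 0%N) ->
  p = poly_in_t (\poly_(k < msize p) p@_(t_mon k)).
Proof.
move=> pt; apply/mpolyP => mon.
have [[k ->]|nmon] := pselect (exists k, mon = t_mon k).
  rewrite poly_in_t_mon coef_poly; case: ltnP => // kp.
  apply: memN_msupp_eq0; apply: msize_mdeg_ge; rewrite /t_mon mdegMn mdeg1 mul1n.
  exact: kp.
rewrite memN_msupp_eq0; last first.
  by apply/negP => /pt/t_monP monE; apply: nmon; exists (mon l).
rewrite memN_msupp_eq0 //; apply/negP => /msupp_poly_in_t[k monE _].
by apply: nmon; exists k.
Qed.

(** The leading monomial of [poly_in_t P] is a multiple of that of some [g] in [G], which is thus a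
    power of the last variable. All monomials of [g] are then such powers, so [g] comes from [hhat]
    and vanishes at [z]. The remainder of [P] modulo [g] stays in [I] and has smaller degree. *)
Lemma groebner_eliminate (I : set {mpoly R[E]}) (G : seq {mpoly R[E]})
    (hhat : seq {mpoly R[1]}) (z : 'I_1 -> R) :
  (forall p q, I p -> I q -> I (p - q)) -> (forall a p, I p -> I (a * p)) ->
  lex_groebner_basis I G ->
  (forall q, (q \in hhat) = (embed_t n m q \in G)) -> zero_set [set` hhat] z ->
  forall P, I (poly_in_t P) -> P.[z ord0] = 0.
Proof.
move=> IB IM [GI ltGI] hhatE zz P.
have [d] := ubnP (size P); elim: d P => // d IH P Pd IP.
have [->|P0] := eqVneq P 0; first by rewrite horner0.
pose p := poly_in_t P.
have p0 : p != 0.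
  apply: contraNneq P0 => p0; rewrite -lead_coef_eq0 lead_coefE -poly_in_t_mon.
  by rewrite -/p p0 mcoeff0.
have lmp := lex_lm_mem p0.
have [j lm_pE Pj] := msupp_poly_in_t lmp.
have ltp : ideal_gen [set lex_lt q | q in [set` G]] (lex_lt p).
  by rewrite ltGI; apply: ideal_gen_mem; exists p.
have lm_ltp : lex_lm p \in msupp (lex_lt p).
  by rewrite /lex_lt msuppMCX ?inE // -mcoeff_msupp.
have [g [Gg g0 [mon' lmE]]] := ideal_gen_monomial ltp lm_ltp.
have lmg0 i : i != l -> lex_lm g i = 0%N.
  move=> il; apply/eqP; have := t_mon_other j il.
  by rewrite -lm_pE lmE mnmDE => /eqP; rewrite addn_eq0 => /andP[].
have g_lex mon : mon \in msupp g ->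
    (forall i, i != l -> mon i = 0%N) /\ (mon l <= lex_lm g l)%N.
  move=> /lex_lm_max lelm; apply: (tuplelexi_le_last _ lelm lmg0) => i.
  by rewrite /l /= addn0 -ltnS -[X in (_ < X)%N]addn1.
pose Q := \poly_(k < msize g) g@_(t_mon k).
have gE : g = poly_in_t Q by apply: poly_in_t_onto => mon /g_lex[].
pose e := lex_lm g l.
have Qe : Q`_e != 0.
  by rewrite -poly_in_t_mon -gE -mcoeff_msupp /e -t_monP // lex_lm_mem.
have Q0 : Q != 0 by apply: contraNneq Qe => ->; rewrite coef0.
have Qsize : (size Q <= e.+1)%N.
  apply/leq_sizeP => k ek; apply: contrapT => /eqP.
  rewrite -poly_in_t_mon -gE -mcoeff_msupp => /g_lex[_].
  by rewrite t_mon_last leqNgt ek.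
have eP : (e < size P)%N.
  have ej : (e <= j)%N.
    by rewrite -(t_mon_last j) -lm_pE lmE mnmDE leq_addr.
  apply: leq_ltn_trans ej _; rewrite ltnNge; apply: contraNN Pj => Pj.
  by rewrite nth_default.
have Qz : Q.[z ord0] = 0.
  by rewrite -mpoly_of_poly_eval; apply: zz; rewrite /= hhatE embed_mpoly_of_poly -gE.
have IPQ : I (poly_in_t (P %% Q)).
  have -> : P %% Q = P - P %/ Q * Q by rewrite {2}(divp_eq P Q) addrAC subrr add0r.
  rewrite poly_in_tB poly_in_tM -gE; apply: IB => //; apply: IM; exact: GI.
rewrite (divp_eq P Q) hornerD hornerM Qz mulr0 add0r IH //.
rewrite -ltnS (leq_trans _ Pd) // ltnS.
by rewrite (leq_trans (ltn_modpN0 _ Q0)) // (leq_trans Qsize).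
Qed.

End Elimination.

Lemma embed_x_eval (R : realType) n m (p : {mpoly R[n]}) (w : 'I_(n + m + 1) -> R) :
  (embed_x m p).@[w] = p.@[fun i => w (lshift 1 (lshift m i))].
Proof.
rewrite /embed_x comp_mpoly_meval; apply: meval_eq => i.
by rewrite tnth_mktuple mevalXU.
Qed.

Lemma embed_t_eval (R : realType) n m (q : {mpoly R[1]}) (w : 'I_(n + m + 1) -> R) :
  (embed_t n m q).@[w] = q.@[fun _ => w (rshift (n + m) ord0)].
Proof.
rewrite /embed_t comp_mpoly_meval; apply: meval_eq => i.
by rewrite tnth_mktuple mevalXU.
Qed.

(** * Real zeros of the lifted system *)

Section LiftedSystem.
Variables (R : realType) (n m k : nat) (f : {mpoly R[n]}).
Variables (g : m.-tuple {mpoly R[n]}) (h : k.-tuple {mpoly R[n]}).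

Definition lifted_system : seq {mpoly R[n + m + 1]} :=
  rcons (h_tilde g h) (var_t R n m - embed_x m f).

(** The square root solves [g_j = y_j ^+ 2] exactly when [g_j] is nonnegative at [x]. *)
Definition lifted_point (x : 'I_n -> R) (i : 'I_(n + m + 1)) : R :=
  match split i with
  | inl i' => match split i' with
              | inl a => x a
              | inr b => Num.sqrt (tnth g b).@[x]
              end
  | inr _ => f.@[x]
  end.

Lemma lifted_systemP (w : 'I_(n + m + 1) -> R) :
  let x := fun i => w (lshift 1 (lshift m i)) in
  zero_set [set` lifted_system] w <->
  [/\ forall j, w (lshift 1 (rshift n j)) ^+ 2 = (tnth g j).@[x],
      zero_set [set` h] x & w (rshift (n + m) ord0) = f.@[x]].
Proof.
move=> x; split=> [wz|[gw hw fw] p].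
  split.
  - move=> j; apply/esym/eqP; rewrite -subr_eq0 -embed_x_eval.
    rewrite -(mevalXU w (lshift 1 (rshift n j))) expr2 -mevalM -mevalB -expr2.
    apply/eqP/wz; rewrite /= mem_rcons inE mem_cat; apply/orP; right.
    by apply/orP; left; apply/codomP; exists j.
  - move=> p ph; rewrite -embed_x_eval; apply: wz => /=.
    by rewrite mem_rcons inE mem_cat map_f ?orbT.
  - apply/eqP; rewrite -subr_eq0 -embed_x_eval -(mevalXU w (rshift _ _)) -mevalB.
    by apply/eqP/wz; rewrite /= mem_rcons mem_head.
rewrite /= mem_rcons inE mem_cat => /or3P[/eqP->|/codomP[j ->]|/mapP[q qh ->]].
- by rewrite mevalB mevalXU fw embed_x_eval subrr.
- by rewrite mevalB expr2 mevalM mevalXU -expr2 gw embed_x_eval subrr.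
- by rewrite embed_x_eval; apply: hw.
Qed.

Lemma lifted_point_zero x : nonneg_set g x -> zero_set [set` h] x ->
  zero_set [set` lifted_system] (lifted_point x).
Proof.
move=> gx hx.
have xE : (fun i => lifted_point x (lshift 1 (lshift m i))) = x.
  by apply/funext => i; rewrite /lifted_point !(unsplitK (inl _ _)).
apply/lifted_systemP; rewrite xE; split=> // [j|].
  by rewrite /lifted_point (unsplitK (inl _ _)) (unsplitK (inr _ _)) sqr_sqrtr.
by rewrite /lifted_point (unsplitK (inr _ _)).
Qed.

End LiftedSystem.

Theorem lemma8 (R : realType) (n m l : nat) (f : {mpoly R[n]})
    (g : m.-tuple {mpoly R[n]}) (h : l.-tuple {mpoly R[n]})
    (hhat : seq {mpoly R[1]}) :
  algorithm_output f g h hhat ->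
  zero_set [set` hhat] =
  zariski_closure
    [set (fun _ : 'I_1 => f.@[x]) | x in nonneg_set g `&` zero_set [set` h]].
Proof.
move=> [hcheck [hG [hcheckE groebner hhatE]]].
(* For the first inclusion, let [q] be one of the polynomials defining a variety that contains the
   image. Lifted by [embed_t], it will vanish on the real zeros of the lifted system, hence lie in
   the real radical, hence vanish at [z]. *)
apply/seteqP; split=> [z zz W [[s ->] AW] q qs|].
  have [P qE] := mpoly_of_poly_onto q.
  rewrite qE mpoly_of_poly_eval.
  apply: (groebner_eliminate _ _ groebner hhatE zz).
  - exact: ideal_genB.
  - exact: ideal_genM.
  rewrite hcheckE; apply: real_nullstellensatz => w.
  rewrite -embed_mpoly_of_poly -qE embed_t_eval => /lifted_systemP[gw hw ->].
  (* At a real zero [g_j] is the square of a coordinate, hence nonnegative: the last coordinate is a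
     value of [f] on the feasible set. *)
  apply: AW qs; eexists; last by [].
  by split=> // j; rewrite -gw sqr_ge0.
apply: smallest_sub; first by exists hhat.
move=> _ [x [gx hx] <-] q; rewrite /= hhatE => qG.
have : ideal_gen [set` hcheck] (embed_t n m q) by case: groebner => + _; apply.
rewrite hcheckE => /real_radical_zero/(_ (lifted_point_zero (f := f) gx hx)).
by rewrite embed_t_eval /lifted_point (unsplitK (inr _ _)).
Qed.
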